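(* If $\mu=\mathcal{N}(m_\mu,\Sigma_\mu)$ and $\nu=\mathcal{N}(m_\nu,\Sigma_\nu)$ are two Gaussian distributions on $\mathbb{R}^d$, then $$\overline{\mathcal{T}}_2(\nu|\mu)=\inf_{\Sigma\leq\Sigma_\nu}W_2^2(\mu,\mathcal{N}(m_\nu,\Sigma))=\|m_\nu-m_\mu\|^2+\inf_{\Sigma\leq\Sigma_\nu}\mathrm{Tr}\Big(\Sigma+\Sigma_\mu-2\big(\Sigma_\mu^{1/2}\Sigma\,\Sigma_\mu^{1/2}\big)^{1/2}\Big),$$ where the infimum runs over all covariance matrices $\Sigma$ (symmetric with nonnegative eigenvalues) such that $\Sigma\leq\Sigma_\nu$ (i.e. $\Sigma_\nu-\Sigma$ is also a covariance matrix). The backward projection of $\mu$ on $\nu$ in the convex order is $\bar\mu=\mathcal{N}(m_\nu,\overline{\Sigma})$, with $\overline{\Sigma}\leq\Sigma_\nu$ the unique minimizer of $\Sigma\mapsto\mathrm{Tr}\Big(\Sigma+\Sigma_\mu-2\big(\Sigma_\mu^{1/2}\Sigma\,\Sigma_\mu^{1/2}\big)^{1/2}\Big)$ (equivalently, of $\Sigma\mapsto W_2^2(\mu,\mathcal{N}(m_\nu,\Sigma))$) over all covariance matrices $\Sigma\leq\Sigma_\nu$.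
   Context: $\|\cdot\|$ is the Euclidean norm; $W_2$ is the quadratic Wasserstein distance. Quadratic barycentric transport cost: $\overline{\mathcal{T}}_2(\nu|\mu)=\inf_{X\sim\mu,\,Y\sim\nu}\mathbb{E}\big(\|\mathbb{E}(Y-X|X)\|^2\big)$. $\eta\leq_c\nu$ (convex order) means $\int h\,\mathrm{d}\eta\leq\int h\,\mathrm{d}\nu$ for every convex $h:\mathbb{R}^d\to\mathbb{R}$. It is known that $\overline{\mathcal{T}}_2(\nu|\mu)=\inf_{\eta\leq_c\nu}W_2^2(\mu,\eta)$ and that this infimum has a unique minimizer $\bar\mu$, called the backward projection of $\mu$ on $\nu$ in the convex order. Gaussian distributions may be degenerate (covariances are symmetric positive semidefinite). *)

(* Defs.v *)
From HB Require Import structures.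
From mathcomp Require Import all_boot all_order all_algebra.
From mathcomp Require Import all_classical all_reals all_analysis.
From mathcomp Require Import measurable_realfun.
Set Implicit Arguments.
Unset Strict Implicit.
Unset Printing Implicit Defensive.
Import Order.TTheory GRing.Theory Num.Theory.
Import numFieldNormedType.Exports.
Local Open Scope classical_set_scope.
Local Open Scope ring_scope.

Definition argmin (T : Type) disp (V : porderType disp) (D : set T)
    (F : T -> V) : set T :=
  [set x | D x /\ forall y, D y -> (F x <= F y)%O].

(* The library's norm on matrices is the sup norm, so the Euclidean norm is
   defined separately. *)
Definition enorm (R : realType) (d : nat) (v : 'cV[R]_d) : R :=
  Num.sqrt (\sum_(i < d) v i ord0 ^+ 2).

Section covariance.
Context {R : realType} {d : nat}.
Implicit Types A B : 'M[R]_d.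

Definition is_covariance A : Prop :=
  A^T = A /\ forall a, eigenvalue A a -> 0 <= a.

Definition cov_le A B : Prop := is_covariance (B - A).

(* The square root A^{1/2} of a covariance matrix A, i.e. the (unique)
   covariance matrix whose square is A; the value is junk if there is none. *)
Definition psd_sqrt A : 'M[R]_d :=
  xget 0 [set B | is_covariance B /\ B *m B = A].

End covariance.

(* R^d is 'cV[R]_d with the sigma-algebra generated by the coordinates, as the
   library does for tuples; it is the Borel sigma-algebra. *)
Definition cV_display : measure_display. Proof. exact. Qed.

Section measurable_cV.
Context {R : realType}.
Variable d : nat.

Let coors : 'I_d -> 'cV[R]_d -> R := fun i v => v i ord0.

Let cV_set0 : g_sigma_preimage coors set0.
Proof. exact: sigma_algebra0. Qed.

Let cV_setC A : g_sigma_preimage coors A -> g_sigma_preimage coors (~` A).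
Proof. exact: sigma_algebraC. Qed.

Let cV_bigcup (F : _^nat) : (forall i, g_sigma_preimage coors (F i)) ->
  g_sigma_preimage coors (\bigcup_i (F i)).
Proof. exact: sigma_algebra_bigcup. Qed.

HB.instance Definition _ := @isMeasurable.Build cV_display
  'cV[R]_d (g_sigma_preimage coors) cV_set0 cV_setC cV_bigcup.

End measurable_cV.


Section cV_measurability.
Context {R : realType}.

Lemma measurable_fun_cVP disp (T : measurableType disp) d (f : T -> 'cV[R]_d) :
  measurable_fun [set: T] f <->
  forall i, measurable_fun [set: T] (fun w => f w i ord0).
Proof.
apply: (@iff_trans _ (g_sigma_preimage
    (fun i : 'I_d => (fun v : 'cV[R]_d => v i ord0) \o f) `<=` measurable)).
  rewrite g_sigma_preimage_comp; split=> [mf A [/= C preC <-]|prefS].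
    exact: mf.
  by move=> _ A mA; apply: prefS; exists A.
split=> [tnthfS i|mf].
- move=> _ A mA.
  apply: tnthfS; apply: sub_sigma_algebra.
  case: d i => [[] []//|d i] in f *.
  rewrite -bigcup_mkord_ord.
  exists i; first exact: ltn_ord.
  by exists A => //; rewrite inord_val.
- apply: smallest_sub; first exact: sigma_algebra_measurable.
  case: d => [|d] in f mf *; first by rewrite big_ord0.
  rewrite -bigcup_mkord_ord; apply: bigcup_sub => i Ii.
  by move=> A [B mB <-]; exact: mf.
Qed.

Lemma measurable_coord d (i : 'I_d) :
  measurable_fun [set: 'cV[R]_d] (fun v => v i ord0).
Proof. by have /measurable_fun_cVP := @measurable_id _ 'cV[R]_d setT; apply. Qed.

Definition affine_cV d (m : 'cV[R]_d) (A : 'M[R]_d) : 'cV[R]_d -> 'cV[R]_d :=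
  fun z => m + A *m z.

Lemma measurable_affine_cV d (m : 'cV[R]_d) (A : 'M[R]_d) :
  measurable_fun [set: 'cV[R]_d] (affine_cV m A).
Proof.
apply/measurable_fun_cVP => i.
rewrite [X in measurable_fun _ X](_ : _ =
    (fun z : 'cV[R]_d => m i ord0 + \sum_(j < d) A i j * z j ord0)); last first.
  by apply/funext => z; rewrite /affine_cV !mxE.
apply: measurable_funD => //; apply: measurable_sum => j.
by apply: measurable_funM => //; exact: measurable_coord.
Qed.

HB.instance Definition _ d (m : 'cV[R]_d) (A : 'M[R]_d) :=
  @isMeasurableFun.Build _ _ _ _ (affine_cV m A) (measurable_affine_cV m A).

Definition cons_cV d (p : measurableTypeR R * 'cV[R]_d) : 'cV[R]_d.+1 :=
  col_mx (p.1 : R)%:M p.2 : 'cV[R]_(1 + d).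

Lemma measurable_cons_cV d :
  measurable_fun [set: (measurableTypeR R * 'cV[R]_d)%type] (@cons_cV d).
Proof.
apply/measurable_fun_cVP => i.
rewrite /cons_cV; case: (splitP (i : 'I_(1 + d))) => j ij.
  rewrite [X in measurable_fun _ X](_ : _ = fst); first exact: measurable_fst.
  apply/funext => p; rewrite (_ : i = lshift d j); last exact/val_inj.
  by rewrite [LHS](@col_mxEu _ 1 d 1) mxE !ord1 eqxx mulr1n.
rewrite [X in measurable_fun _ X](_ : _ =
    (fun v : 'cV[R]_d => v j ord0) \o snd).
  by apply: measurableT_comp; [exact: measurable_coord|exact: measurable_snd].
apply/funext => p; rewrite (_ : i = rshift 1 j); last exact/val_inj.
exact: (@col_mxEd _ 1 d 1).
Qed.

HB.instance Definition _ d :=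
  @isMeasurableFun.Build _ _ _ _ (@cons_cV d) (@measurable_cons_cV d).

End cV_measurability.

Section gaussian.
Context {R : realType}.

(* The law N(0, I_d) of d independent N(0, 1) variables. *)
Fixpoint std_gaussian (d : nat) : probability 'cV[R]_d R :=
  match d with
  | 0 => dirac (0 : 'cV[R]_0)
  | d'.+1 => distribution (normal_prob 0 1 \x std_gaussian d')%E (@cons_cV R d')
  end.

(* N(m, S), possibly degenerate: the law of m + S^{1/2} Z, Z ~ N(0, I_d). *)
Definition gaussian d (m : 'cV[R]_d) (S : 'M[R]_d) : probability 'cV[R]_d R :=
  distribution (std_gaussian d) (affine_cV m (psd_sqrt S)).

End gaussian.

Section transport.
Context {R : realType} {d : nat}.
Implicit Types mu nu eta : probability 'cV[R]_d R.

(* A measure is a function on all sets, whose values outside the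
   sigma-algebra are irrelevant. *)
Definition same_law mu nu : Prop := forall A, measurable A -> mu A = nu A.

Definition has_law disp (T : measurableType disp) (P : probability T R)
    (X : {mfun T >-> 'cV[R]_d}) mu : Prop :=
  same_law (distribution P X) mu.

Definition W2 mu nu : \bar R :=
  sqrte (ereal_inf [set c | exists disp (T : measurableType disp)
      (P : probability T R) (X Y : {mfun T >-> 'cV[R]_d}),
    [/\ has_law P X mu, has_law P Y nu &
        c = (\int[P]_w (enorm (X w - Y w) ^+ 2)%:E)%E]]).

(* Z is a version of E(V | G), coordinate by coordinate, where G is a
   sub-sigma-algebra. *)
Definition is_cond_exp disp (T : measurableType disp) (P : probability T R)
    (G : set (set T)) (V Z : T -> 'cV[R]_d) : Prop :=
  forall i : 'I_d,
  [/\ P.-integrable setT (fun w => (V w i ord0)%:E),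
      P.-integrable setT (fun w => (Z w i ord0)%:E),
      (forall B : set R, measurable B -> G ((fun w => Z w i ord0) @^-1` B)) &
      (forall A, G A ->
        (\int[P]_(w in A) (Z w i ord0)%:E = \int[P]_(w in A) (V w i ord0)%:E)%E)].

Definition sigma_of disp (T : measurableType disp) (X : T -> 'cV[R]_d) :
    set (set T) :=
  preimage_set_system setT X measurable.

(* bary_cost nu mu is the cost of nu given mu, in this order; Z = E(Y - X | X). *)
Definition bary_cost nu mu : \bar R :=
  ereal_inf [set c | exists disp (T : measurableType disp)
      (P : probability T R) (X Y : {mfun T >-> 'cV[R]_d}) (Z : T -> 'cV[R]_d),
    [/\ has_law P X mu, has_law P Y nu,
        is_cond_exp P (sigma_of X) (fun w => Y w - X w) Z &
        c = (\int[P]_w (enorm (Z w) ^+ 2)%:E)%E]].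

(* Convex functions on R^d are continuous, hence measurable. If nu has a finite
   first moment, then so does eta (take h the norm), and all the integrals are
   well defined in ]-oo, +oo]. *)
Definition convex_le eta nu : Prop :=
  forall h : 'cV[R]_d -> R, convex_function (E := 'cV[R]_d) setT h ->
  (\int[eta]_x (h x)%:E <= \int[nu]_x (h x)%:E)%E.

(* mubar is the unique minimizer, up to equality on measurable sets. *)
Definition is_backward_projection mu nu mubar : Prop :=
  forall eta,
    argmin [set xi | convex_le xi nu] (fun xi => W2 mu xi ^+ 2)%E eta <->
    same_law eta mubar.

End transport.

(* Main.v *)
(** With a = S_mu^{1/2}, the Bures functional F(S) is the least squared Frobenius
distance from a to the matrices B with B B^T = S. So minimizing F over S <= S_nu
amounts to projecting a on the convex compact set {B | B B^T <= S_nu}; let B be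
this projection and C = B a^+, so that C a = B. The coupling
X |-> Y* = m_nu + C (X - m_mu) costs V = |m_nu - m_mu|^2 + |B - a|^2, and the
variational inequality of the projection reads E<Y - Y*, Y* - X> >= 0 for every
Y that is dominated by nu in the convex order, since only its first two moments
enter. Expanding the square, E|X - Y|^2 >= V + E|Y - Y*|^2: this is the lower
bound, and the law of a near optimal Y is close to that of Y*. As Y* - X is a
function of X, the same inequality bounds the barycentric cost from below, and
V is attained by adding to Y* an independent Gaussian noise, of covariance
S_nu - B B^T. The facts on Gaussian laws all follow from the law of A Z
depending only on A A^T, which is the invariance of N(0, I) under rotations. *)

From HB Require Import structures.
Require Import Defs.
From mathcomp Require Import all_boot all_order all_algebra.
From mathcomp Require Import all_classical all_reals all_analysis.
From mathcomp Require Import measurable_realfun ring lra complex.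

Set Implicit Arguments.
Unset Strict Implicit.
Unset Printing Implicit Defensive.
Import Order.TTheory GRing.Theory Num.Theory.
Import numFieldNormedType.Exports.
Local Open Scope classical_set_scope.
Local Open Scope ring_scope.

(** * Orthogonal and symmetric matrices *)

(** Degenerate covariances shape the argument. When [a] is singular, [C a = B] is solvable only if
    [B] vanishes on the kernel of [a]. Minimality gives this: composing [B] with the orthogonal
    projector on the range of [a] keeps it admissible and would otherwise bring it closer to [a]. In
    the same way, positivity of the joint covariance of [Y] and [X] makes the cross-covariance [L]
    vanish on that kernel, so that [L = B' a] with [B' = L a^+], and a Schur complement bounds
    [B' B'^T] by the covariance of [Y]. An arbitrary coupling, Gaussian or not, thus becomes a point
    [B'] of the convex set on which [a] is projected.

    Convexity is gained by passing from covariances to their factors: [B B^T <= S_nu] says that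
    [|B^T u|^2 <= u^T S_nu u] for all [u]. For uniqueness, optimal couplings are replaced by
    couplings of cost below [V + e]: these put [Y] within [e], in mean square, of a vector whose law
    is that of [Y*], and a law that is arbitrarily close to a fixed one is equal to it. *)

Section rotations.
Context {R : rcfType}.

(* The orthogonal matrices, through generators that act on one or two
   consecutive coordinates: invariance of std_gaussian under them is then an
   induction along its definition. *)
Inductive rotation : forall n, 'M[R]_n -> Prop :=
| rotation1 n : @rotation n 1%:M
| rotationM n (U V : 'M[R]_n) : rotation U -> rotation V -> rotation (U *m V)
| rotation_lift n (U : 'M[R]_n) : rotation U ->
    @rotation (1 + n) (block_mx 1%:M 0 0 U)
| rotation_flip n : @rotation (1 + n) (block_mx (- 1)%:M 0 0 1%:M)
| rotation_plane n c s : c ^+ 2 + s ^+ 2 = 1 ->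
    @rotation (1 + (1 + n))
      (block_mx c%:M (row_mx (- s)%:M 0) (col_mx s%:M 0)
                (block_mx c%:M 0 0 1%:M)).

Lemma rotation_orth n (U : 'M[R]_n) : rotation U -> U^T *m U = 1%:M.
Proof.
elim=> {n U} [n|n U V _ IU _ IV|n U _ IU|n|n c s cs].
- by rewrite trmx1 mulmx1.
- by rewrite trmx_mul mulmxA -(mulmxA V^T) IU mulmx1.
- rewrite tr_block_mx mulmx_block !trmx0 trmx1 !mulmx0 !mul0mx !addr0 !add0r.
  by rewrite mulmx1 IU -scalar_mx_block.
- rewrite tr_block_mx mulmx_block !trmx0 trmx1 !mulmx0 !mul0mx !addr0 !add0r.
  by rewrite mulmx1 tr_scalar_mx -scalar_mxM mulrNN mulr1 -scalar_mx_block.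
- rewrite !tr_block_mx tr_row_mx tr_col_mx !trmx0 trmx1 !tr_scalar_mx.
  rewrite mulmx_block mul_row_col mul_mx_row mul_row_block mul_col_mx.
  rewrite mul_block_col mul_col_row mulmx_block.
  rewrite !mul0mx !mulmx0 !addr0 !add0r mulmx1 -!scalar_mxM add_block_mx.
  rewrite add_row_mx add_col_mx !addr0 !add0r -!raddfD /= -!expr2 cs.
  rewrite sqrrN [s ^+ 2 + _]addrC cs mulrN mulNr.
  rewrite [c * s]mulrC addNr.
  rewrite raddf0 row_mx0 col_mx0 -scalar_mx_block.
  by rewrite -scalar_mx_block.
Qed.

Lemma rotation_tr n (U : 'M[R]_n) : rotation U -> rotation U^T.
Proof.
elim=> {n U} [n|n U V _ IU _ IV|n U _ IU|n|n c s cs].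
- by rewrite trmx1; exact: rotation1.
- by rewrite trmx_mul; exact: rotationM.
- by rewrite tr_block_mx !trmx0 trmx1; exact: rotation_lift.
- by rewrite tr_block_mx !trmx0 trmx1 tr_scalar_mx; exact: rotation_flip.
- rewrite tr_block_mx tr_block_mx tr_row_mx tr_col_mx !trmx0 trmx1.
  rewrite !tr_scalar_mx -{1}[s]opprK; apply: rotation_plane.
  by rewrite sqrrN.
Qed.

Lemma orthC n (U : 'M[R]_n) : U^T *m U = 1%:M -> U *m U^T = 1%:M.
Proof. exact: mulmx1C. Qed.

Lemma dotE n (v : 'cV[R]_n) : (v^T *m v) 0 0 = \sum_i v i 0 ^+ 2.
Proof. by rewrite mxE; apply: eq_bigr => i _; rewrite !mxE expr2. Qed.

Lemma dot_ge0 n (v : 'cV[R]_n) : 0 <= (v^T *m v) 0 0.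
Proof. by rewrite dotE sumr_ge0// => i _; rewrite sqr_ge0. Qed.

Lemma dot_eq0 n (v : 'cV[R]_n) : (v^T *m v) 0 0 = 0 -> v = 0.
Proof.
rewrite dotE => /eqP; rewrite psumr_eq0; last by move=> i _; rewrite sqr_ge0.
move=> /allP v0; apply/colP => i; rewrite mxE.
by have := v0 i; rewrite mem_index_enum sqrf_eq0 => /(_ isT) /eqP.
Qed.

(** Induction on the dimension: the tail is rotated onto its own first axis, then one plane rotation
    removes the second coordinate. In dimension one only a sign is left to correct, which is the
    task of the flip. *)
Lemma rotation_to_axis n (v : 'cV[R]_(1 + n)) :
  exists U, rotation U /\ U *m v = col_mx (Num.sqrt ((v^T *m v) 0 0))%:M 0.
Proof.
elim: n v => [|n IH] v.
  set x := v 0 0.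
  have vE : v = col_mx x%:M 0.
    rewrite -[LHS]vsubmxK; congr col_mx; last by rewrite [LHS]flatmx0.
    by apply/colP => i; rewrite (ord1 i) !mxE lshift0 mulr1n.
  have -> : Num.sqrt ((v^T *m v) 0 0) = `|x|.
    by rewrite dotE big_ord1 sqrtr_sqr.
  have [x0|x0] := leP 0 x.
    by exists 1%:M; split; [exact: rotation1|rewrite mul1mx ger0_norm].
  exists (block_mx (-1)%:M 0 0 1%:M); split; first exact: rotation_flip.
  rewrite [in LHS]vE mul_block_col !mul0mx !mulmx0 !addr0 -scalar_mxM mulN1r.
  by rewrite ltr0_norm.
move: v; change n.+1 with (1 + n)%N => v.
set x := v 0 0; set y := dsubmx v.
have vE : v = col_mx x%:M y.
  rewrite -[LHS]vsubmxK; congr col_mx; apply/colP => i; rewrite (ord1 i) !mxE.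
  by rewrite lshift0 mulr1n.
have [U [rU Uy]] := IH y.
set q := Num.sqrt _ in Uy; set r := Num.sqrt _.
have rE : r ^+ 2 = x ^+ 2 + q ^+ 2.
  rewrite !sqr_sqrtr ?dot_ge0// vE tr_col_mx mul_row_col mxE.
  by rewrite tr_scalar_mx -scalar_mxM mxE mulr1n expr2.
have [r0|r0] := eqVneq r 0.
  have v0 : v = 0.
    apply: dot_eq0; rewrite -[LHS]sqr_sqrtr ?dot_ge0// -/r r0.
    by rewrite expr0n.
  exists 1%:M; split; first exact: rotation1.
  by rewrite v0 r0 mulmx0 raddf0 col_mx0.
(* Cosine [x / r] and sine [- q / r] send [(x, q)] to [(r, 0)]. *)
exists (block_mx (x / r)%:M (row_mx (- (- q / r))%:M 0) (col_mx (- q / r)%:M 0)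
                (block_mx (x / r)%:M 0 0 1%:M) *m block_mx 1%:M 0 0 U); split.
  apply: rotationM; last exact: rotation_lift.
  by apply: rotation_plane; rewrite mulNr sqrrN !expr_div_n -mulrDl -rE divff// sqrf_eq0.
rewrite -mulmxA [in X in _ *m X]vE mul_block_col !mul0mx addr0 mul1mx add0r Uy.
rewrite mul_block_col mul_row_col mul_block_col mul_col_mx !mul0mx !mulmx0.
rewrite !addr0 -!scalar_mxM add_col_mx -!raddfD /=.
have -> : x / r * x + - (- q / r) * q = r.
  have -> : x / r * x + - (- q / r) * q = (x ^+ 2 + q ^+ 2) / r by field.
  by rewrite -rE expr2 mulfK.
have -> : - q / r * x + x / r * q = 0 by field.
by rewrite raddf0 addr0 col_mx0.
Qed.

(** Equal Gram matrices mean equal lengths and angles of the columns, so both first columns can be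
    rotated to the same axis vector. The result serves as polar decomposition for the Bures
    functional, and it compares two factors of one covariance for Gaussian laws. *)
Lemma gram_rotation k n (A B : 'M[R]_(n, k)) : A^T *m A = B^T *m B ->
  exists2 U, rotation U & A = U *m B.
Proof.
elim: k n A B => [|k IH] n A B.
  by move=> _; exists 1%:M; [exact: rotation1|rewrite mul1mx !thinmx0].
case: n A B => [|n] A B.
  by move=> _; exists 1%:M; [exact: rotation1|rewrite mul1mx !flatmx0].
move: A B; change k.+1 with (1 + k)%N; change n.+1 with (1 + n)%N => A B.
rewrite -{1 2}(hsubmxK A) -{1 2}(hsubmxK B).
set a := lsubmx A; set A' := rsubmx A; set b := lsubmx B; set B' := rsubmx B.
rewrite !tr_row_mx !mul_col_row => /eq_block_mx[ab aA _ AB].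
have [U [rU Ua]] := rotation_to_axis a; have [V [rV Vb]] := rotation_to_axis b.
rewrite -ab in Vb; set r := Num.sqrt _ in Ua Vb.
have UU := rotation_orth rU; have VV := rotation_orth rV.
have [r0|r0] := eqVneq r 0.
  have a0 : a = 0.
    rewrite -[a]mul1mx -UU -mulmxA Ua r0.
    by rewrite raddf0 col_mx0 mulmx0.
  have b0 : b = 0.
    rewrite -[b]mul1mx -VV -mulmxA Vb r0.
    by rewrite raddf0 col_mx0 mulmx0.
  have [W rW AWB] := IH _ _ _ AB.
  by exists W => //; rewrite -(hsubmxK A) -(hsubmxK B) -/a -/A' -/b -/B'
    mul_mx_row -AWB a0 b0 mulmx0.
have UAE : (U *m a)^T *m (U *m A') = a^T *m A'.
  by rewrite trmx_mul mulmxA -(mulmxA a^T) UU mulmx1.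
have VBE : (V *m b)^T *m (V *m B') = b^T *m B'.
  by rewrite trmx_mul mulmxA -(mulmxA b^T) VV mulmx1.
have UAA : (U *m A')^T *m (U *m A') = A'^T *m A'.
  by rewrite trmx_mul mulmxA -(mulmxA A'^T) UU mulmx1.
have VBB : (V *m B')^T *m (V *m B') = B'^T *m B'.
  by rewrite trmx_mul mulmxA -(mulmxA B'^T) VV mulmx1.
(* Products with the first column now read as [r] times the first row of the remaining columns. As
   [r != 0] these rows agree, and they cancel from the Gram identity, which leaves the induction
   hypothesis one dimension lower. *)
move: UAE VBE UAA VBB; rewrite Ua Vb.
rewrite -(vsubmxK (U *m A')) -(vsubmxK (V *m B')).
set p := usubmx (U *m _); set A2 := dsubmx (U *m _).
set q := usubmx (V *m _); set B2 := dsubmx (V *m _).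
rewrite !tr_col_mx !mul_row_col !trmx0 !mul0mx !addr0 tr_scalar_mx.
rewrite !mul_scalar_mx aA => <- /(scalerI r0) qp; rewrite qp AB => <-.
move=> /addrI/esym AB2.
have [W rW AWB] := IH _ _ _ AB2.
exists (U^T *m (block_mx 1%:M 0 0 W *m V)).
  by apply: rotationM; [exact: rotation_tr|apply: rotationM => //; exact: rotation_lift].
rewrite -!mulmxA -[LHS]mul1mx -UU -mulmxA; congr (_ *m _).
rewrite -(hsubmxK A) -(hsubmxK B) -/a -/A' -/b -/B' !mul_mx_row Ua Vb.
rewrite -(vsubmxK (U *m A')) -(vsubmxK (V *m B')).
rewrite -/p -/A2 -/q -/B2 !mul_block_col !mul0mx !mulmx0 !addr0 !add0r !mul1mx.
by rewrite qp AWB.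
Qed.

End rotations.

Section spectral.
Context {R : rcfType}.

(** A complex left eigenvector [w] exists by algebraic closedness. As [A] is real and symmetric,
    [w A w^*] is both [z |w|^2] and [z^* |w|^2], so [z] is real and is already an eigenvalue over
    [R]. *)
Lemma sym_eigenvalue n (A : 'M[R]_n) : (0 < n)%N -> A^T = A ->
  exists a, eigenvalue A a.
Proof.
move=> n0 symA.
pose f : {rmorphism R -> R[i]} := real_complex R.
have [z /eigenvalueP[w wA w0]] := eigenvalue_closed (map_mx f A) n0.
pose wc := (map_mx Num.conj w)^T.
have fC x : Num.conj (f x) = f x.
  by apply/CrealP/complex_realP; exists x.
have ww : w *m wc != 0.
  apply: contra_neq w0 => /matrixP/(_ 0 0); rewrite !mxE => /eqP.
  rewrite psumr_eq0 => [/allP h|i _]; last by rewrite !mxE mul_conjC_ge0.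
  apply/rowP => i; have := h i; rewrite mem_index_enum !mxE => /(_ isT).
  by rewrite mul_conjC_eq0 => /eqP.
have : z^* *: (w *m wc) = z *: (w *m wc).
  rewrite [RHS]scalemxAl -wA -mulmxA [RHS](_ : _ = w *m (map_mx Num.conj (w *m map_mx f A))^T).
    rewrite wA map_mxZ linearZ /= -scalemxAr //.
  rewrite map_mxM trmx_mul; congr (_ *m (_ *m _)).
  by apply/matrixP => i j; rewrite !mxE; apply/esym; rewrite -[in RHS]symA mxE; exact: fC.
move=> /eqP; rewrite -subr_eq0 -scalerBl scaler_eq0 (negbTE ww) orbF subr_eq0.
move=> /eqP /CrealP /complex_realP[a za].
by exists a; rewrite -(eigenvalue_map f); apply/eigenvalueP; exists w; rewrite // wA za.
Qed.

(** Deflation: a rotation [U] takes an eigenvector to the first axis, so the first column of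
    [U A U^T] is a multiple of that axis; symmetry clears the first row as well and leaves a smaller
    symmetric block. *)
Theorem sym_spectral n (A : 'M[R]_n) : A^T = A ->
  exists U (d : 'rV[R]_n), U^T *m U = 1%:M /\ A = U^T *m diag_mx d *m U.
Proof.
elim: n A => [|n IH] A symA.
  by exists 1%:M, 0; split; [rewrite trmx1 mulmx1|rewrite !thinmx0].
have [a /eigenvalueP[w wA w0]] := sym_eigenvalue (ltn0Sn n) symA.
move: A symA w wA w0; change n.+1 with (1 + n)%N => A symA w wA w0.
have [U [/rotation_orth UU Uw]] := rotation_to_axis w^T.
set r := Num.sqrt _ in Uw.
have r0 : r != 0.
  apply: contra_neq w0 => r0.
  rewrite -[w]trmxK -[w^T]mul1mx -UU -mulmxA Uw r0.
  by rewrite raddf0 col_mx0 mulmx0 trmx0.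
have UU' := orthC UU.
pose A' := U *m A *m U^T.
have symA' : A'^T = A' by rewrite /A' !trmx_mul trmxK symA mulmxA.
have A'e : A' *m col_mx r%:M 0 = a *: col_mx r%:M 0.
  by rewrite -Uw /A' mulmxA -(mulmxA _ U^T) UU mulmx1 -!mulmxA -{1}symA -trmx_mul wA linearZ /= -scalemxAr.
have {}A'e : lsubmx A' = col_mx a%:M 0.
  apply: (scalerI r0); rewrite -mul_mx_scalar.
  move: A'e; rewrite -{1}(hsubmxK A') mul_row_col mulmx0 addr0 => ->.
  by rewrite !scale_col_mx !scaler0 !scale_scalar_mx mulrC.
pose C := dsubmx (rsubmx A').
have A'b : A' = block_mx a%:M (usubmx (rsubmx A')) 0 C.
  by rewrite block_mxEh -A'e vsubmxK hsubmxK.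
have := symA'; rewrite {1 2}A'b tr_block_mx => /eq_block_mx[_ b0 _ symC].
have A'E : A' = block_mx a%:M 0 0 C by rewrite {1}A'b -b0 trmx0.
have [V [c [VV CE]]] := IH C symC.
exists (block_mx 1%:M 0 0 V *m U), (row_mx a%:M c); split.
  rewrite trmx_mul mulmxA -(mulmxA U^T) tr_block_mx !trmx0 trmx1 mulmx_block.
  by rewrite !mulmx0 !mul0mx !addr0 !add0r mulmx1 VV -scalar_mx_block mulmx1.
have -> : A = U^T *m block_mx a%:M 0 0 C *m U.
  by rewrite -A'E /A' !mulmxA UU mul1mx -mulmxA UU mulmx1.
rewrite trmx_mul -!mulmxA; congr (_ *m _); rewrite !mulmxA; congr (_ *m _).
rewrite tr_block_mx !trmx0 trmx1 diag_mx_row !mulmx_block.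
rewrite !mulmx0 !mul0mx !addr0 !add0r mul1mx mulmx1 -CE.
rewrite !mul0mx; congr block_mx.
by apply/matrixP => i j; rewrite !ord1 !mxE.
Qed.

Lemma congr_diag_sym n (U : 'M[R]_n) (d : 'rV[R]_n) :
  (U^T *m diag_mx d *m U)^T = U^T *m diag_mx d *m U.
Proof. by rewrite !trmx_mul trmxK tr_diag_mx mulmxA. Qed.

Lemma congr_diagM n (U : 'M[R]_n) (c d : 'rV[R]_n) : U^T *m U = 1%:M ->
  U^T *m diag_mx c *m U *m (U^T *m diag_mx d *m U) =
  U^T *m diag_mx (\row_i (c 0 i * d 0 i)) *m U.
Proof.
move=> /orthC UU; rewrite !mulmxA -(mulmxA _ U) UU mulmx1.
congr (_ *m _); rewrite -mulmxA; congr (_ *m _).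
apply/matrixP => i j; rewrite mul_diag_mx !mxE.
by case: eqP => [->|]; rewrite ?mulr1n// ?mulr0n mulr0.
Qed.

(* The Moore-Penrose inverse of a symmetric matrix; in its spectral form the
   convention 0^-1 = 0 gives the right value on the kernel. *)
Lemma sym_pinv n (A : 'M[R]_n) : A^T = A ->
  exists B, [/\ B^T = B, A *m B = B *m A, A *m B *m A = A & B *m A *m B = B].
Proof.
move=> /sym_spectral[U [d [UU ->]]].
exists (U^T *m diag_mx (\row_i (d 0 i)^-1) *m U).
split; rewrite ?congr_diag_sym ?congr_diagM//; congr (_ *m diag_mx _ *m _);
  apply/rowP => i; rewrite !mxE; have [->|d0] := eqVneq (d 0 i) 0;
  by rewrite ?(invr0, mul0r, mulr0)// 1?mulrC// ?mulfV// ?mulVf// ?mul1r// mulr1.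
Qed.

End spectral.

(** * Covariance matrices and the Bures functional *)

Section frobenius.
Context {R : realType}.

Lemma frobE m n (A B : 'M[R]_(m, n)) :
  \tr (A^T *m B) = \sum_j \sum_i A i j * B i j.
Proof.
by apply: eq_bigr => j _; rewrite mxE; apply: eq_bigr => i _; rewrite mxE.
Qed.

Lemma frob_ge0 m n (A : 'M[R]_(m, n)) : 0 <= \tr (A^T *m A).
Proof.
by rewrite frobE sumr_ge0// => j _; rewrite sumr_ge0// => i _; rewrite -expr2 sqr_ge0.
Qed.

Lemma frob_eq0 m n (A : 'M[R]_(m, n)) : \tr (A^T *m A) = 0 -> A = 0.
Proof.
move=> /eqP; rewrite frobE psumr_eq0; last first.
  by move=> j _; rewrite sumr_ge0// => i _; rewrite -expr2 sqr_ge0.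
move=> /allP A0; apply/matrixP => i j; rewrite mxE.
have := A0 j; rewrite mem_index_enum => /(_ isT) /=.
rewrite psumr_eq0; last by move=> k _; rewrite -expr2 sqr_ge0.
move=> /allP/(_ i); rewrite mem_index_enum -expr2 sqrf_eq0 => /(_ isT).
by move=> /eqP.
Qed.

Lemma frobC m n (A B : 'M[R]_(m, n)) : \tr (A^T *m B) = \tr (B^T *m A).
Proof. by rewrite -mxtrace_tr trmx_mul trmxK. Qed.

Lemma frobD m n (A B : 'M[R]_(m, n)) : \tr ((A + B)^T *m (A + B)) =
  \tr (A^T *m A) + \tr (B^T *m B) + 2 * \tr (A^T *m B).
Proof.
rewrite [(A + B)^T]raddfD /= mulmxDl !mulmxDr !mxtraceD (frobC B A).
by ring.
Qed.

Lemma frobB m n (A B : 'M[R]_(m, n)) : \tr ((A - B)^T *m (A - B)) =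
  \tr (A^T *m A) + \tr (B^T *m B) - 2 * \tr (A^T *m B).
Proof.
rewrite frobD [(- B)^T]raddfN /= mulNmx !mulmxN !raddfN /= opprK.
by ring.
Qed.

End frobenius.

Section covariance_matrices.
Context {R : realType} {d : nat}.
Implicit Types A B S T : 'M[R]_d.

Lemma congr_diag_form (U : 'M[R]_d) (c : 'rV[R]_d) (u : 'cV[R]_d) :
  (u^T *m (U^T *m diag_mx c *m U) *m u) 0 0 = \sum_i c 0 i * (U *m u) i 0 ^+ 2.
Proof.
rewrite !mulmxA -trmx_mul -mulmxA mxE; apply: eq_bigr => i _.
rewrite mul_mx_diag !mxE; ring.
Qed.

Lemma covarianceP A : is_covariance A <->
  A^T = A /\ forall u : 'cV_d, 0 <= (u^T *m A *m u) 0 0.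
Proof.
split=> -[symA posA]; split=> //.
- move=> u; have [U [c [UU AE]]] := sym_spectral symA.
  rewrite AE congr_diag_form sumr_ge0// => i _; rewrite mulr_ge0 ?sqr_ge0//.
  (* Eigenvectors are rows: row [i] of [U] belongs to [c 0 i], and it is nonzero since [U U^T] has
     ones on its diagonal. *)
  apply: posA; apply/eigenvalueP; exists (row i U).
    rewrite {1}AE -row_mul mulmxA mulmxA (orthC UU) mul1mx.
    by apply/rowP => j; rewrite mul_diag_mx !mxE.
  apply/eqP => Ui0; have /matrixP/(_ i i)/eqP := orthC UU.
  rewrite !mxE eqxx big1 ?(eq_sym 0) ?oner_eq0// => j _.
  by move/rowP : Ui0 => /(_ j); rewrite !mxE => ->; rewrite mul0r.
- move=> a /eigenvalueP[v vA v0].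
  have : 0 < (v *m v^T) 0 0.
    have := dot_ge0 v^T; rewrite le_eqVlt => /predU1P[/esym/dot_eq0|].
      by move=> /(congr1 trmx); rewrite trmxK trmx0 => v0'; rewrite v0' eqxx in v0.
    by rewrite trmxK.
  move=> vv; have := posA v^T; rewrite trmxK vA -scalemxAl mxE.
  by rewrite pmulr_lge0.
Qed.

Lemma covariance_sym A : is_covariance A -> A^T = A.
Proof. by case. Qed.

Lemma covariance_gram n (B : 'M[R]_(d, n)) : is_covariance (B *m B^T).
Proof.
apply/covarianceP; split; first by rewrite trmx_mul trmxK.
by move=> u; rewrite !mulmxA -mulmxA -{1}[B]trmxK -trmx_mul dot_ge0.
Qed.

Lemma covariance_sqrt A : is_covariance A ->
  exists B, is_covariance B /\ B *m B = A.
Proof.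
move=> covA; have [U [c [UU AE]]] := sym_spectral (covariance_sym covA).
exists (U^T *m diag_mx (\row_i Num.sqrt (c 0 i)) *m U); split.
  apply/covarianceP; split; first exact: congr_diag_sym.
  move=> u; rewrite congr_diag_form sumr_ge0// => i _.
  by rewrite mulr_ge0 ?sqr_ge0// mxE sqrtr_ge0.
rewrite congr_diagM// AE; congr (_ *m diag_mx _ *m _); apply/rowP => i.
rewrite !mxE -expr2 sqr_sqrtr//.
(* The form at [U^T e_i] isolates the [i]-th spectral value, which is therefore nonnegative. *)
have /covarianceP[_ /(_ (U^T *m delta_mx i 0))] := covA.
rewrite AE congr_diag_form mulmxA (orthC UU) mul1mx (bigD1 i)//= big1.
  by rewrite !mxE !eqxx expr1n mulr1 addr0.
by move=> j /negbTE ji; rewrite !mxE ji expr0n mulr0.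
Qed.

Lemma psd_sqrtP A : is_covariance A ->
  is_covariance (psd_sqrt A) /\ psd_sqrt A *m psd_sqrt A = A.
Proof. by move=> /covariance_sqrt; exact: (@xgetPex _ 0). Qed.

Lemma cov_leP A B : A^T = A -> B^T = B -> cov_le A B <->
  forall u : 'cV_d, (u^T *m A *m u) 0 0 <= (u^T *m B *m u) 0 0.
Proof.
move=> symA symB; split=> [/covarianceP[_ h] u|h].
  by have := h u; rewrite mulmxBr mulmxBl !mxE subr_ge0.
apply/covarianceP; split; first by rewrite linearB /= symA symB.
by move=> u; rewrite mulmxBr mulmxBl !mxE subr_ge0; have := h u; rewrite !mxE.
Qed.

(** With [T = t^2], expand [|t U^T - t|^2 >= 0]: the left side is [2 tr T - 2 tr (U T)]. *)
Lemma tr_orth_le T (U : 'M[R]_d) : is_covariance T -> U^T *m U = 1%:M ->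
  \tr (U *m T) <= \tr T.
Proof.
move=> /covariance_sqrt[t [covt <-]] UU.
have symt := covariance_sym covt.
have := frob_ge0 (t *m U^T - t); rewrite frobB trmx_mul trmxK symt.
rewrite (mxtrace_mulC (U *m t)) (mulmxA _ U t) -(mulmxA t U^T U) UU mulmx1.
by rewrite -(mulmxA U); lra.
Qed.

(* The Bures functional is the least squared Frobenius distance from
   S_mu^{1/2} to the matrices B with B B^T = S. *)
Lemma bures_ex a S : a^T = a -> is_covariance S ->
  exists2 B, B *m B^T = S &
    \tr (S + a *m a - 2 *: psd_sqrt (a *m S *m a)) =
    \tr ((B - a)^T *m (B - a)).
Proof.
move=> syma covS; have [covs sE] := psd_sqrtP covS.
have syms := covariance_sym covs.
set s := psd_sqrt S in sE syms *.
have covaSa : is_covariance (a *m S *m a).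
  have -> : a *m S *m a = (a *m s) *m (a *m s)^T.
    by rewrite trmx_mul syma syms -sE !mulmxA.
  exact: covariance_gram.
have [covT TE] := psd_sqrtP covaSa; set T := psd_sqrt _ in covT TE *.
(* Polar decomposition: [T] and [s a] have the same Gram matrix [a S a]. The factor [s U^T] of [S]
   then makes the cross term equal to [tr T]. *)
have [U /rotation_orth UU TU] : exists2 U, rotation U & T = U *m (s *m a).
  apply: gram_rotation; rewrite (covariance_sym covT) TE trmx_mul syma syms.
  by rewrite -sE !mulmxA.
exists (s *m U^T); first by rewrite trmx_mul trmxK syms mulmxA -(mulmxA s) UU mulmx1.
rewrite frobB trmx_mul trmxK syms syma -!(mulmxA U) -TU.
rewrite (mxtrace_mulC U) -!mulmxA UU mulmx1 sE.
by rewrite raddfB raddfD /= mxtraceZ.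
Qed.

(** The cross term is [tr (B^T a)], and [B^T a] has the same Gram matrix [a S a] as [T]. Hence it is
    [U T] for a rotation [U], and its trace is at most [tr T]. *)
Lemma bures_le a S B : a^T = a -> is_covariance S -> B *m B^T = S ->
  \tr (S + a *m a - 2 *: psd_sqrt (a *m S *m a)) <=
  \tr ((B - a)^T *m (B - a)).
Proof.
move=> syma covS BE.
have covaSa : is_covariance (a *m S *m a).
  have -> : a *m S *m a = (a *m B) *m (a *m B)^T.
    by rewrite trmx_mul syma -BE !mulmxA.
  exact: covariance_gram.
have [covT TE] := psd_sqrtP covaSa; set T := psd_sqrt _ in covT TE *.
have [U /rotation_orth UU TU] : exists2 U, rotation U & B^T *m a = U *m T.
  apply: gram_rotation; rewrite (covariance_sym covT) TE trmx_mul syma trmxK.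
  by rewrite -BE !mulmxA.
rewrite frobB syma TU mxtrace_mulC BE raddfB raddfD /= mxtraceZ.
by rewrite lerD2l lerN2 ler_pM2l// tr_orth_le.
Qed.

End covariance_matrices.

(** * Projection on the factors of the admissible covariances *)

Section projection.
Context {R : realType} {d : nat}.
Variables (a S : 'M[R]_d).
Hypothesis covS : is_covariance S.

Let K := [set B : 'M[R]_d | cov_le (B *m B^T) S].

(** In this form, closedness and convexity in [B] are visible for each [u] separately. *)
Let KP B : K B <->
  forall u : 'cV_d, ((B^T *m u)^T *m (B^T *m u)) 0 0 <= (u^T *m S *m u) 0 0.
Proof.
rewrite /K /= cov_leP; last 2 first.
- by rewrite trmx_mul trmxK.
- exact: covariance_sym.
by split=> h u; have := h u; rewrite trmx_mul trmxK !mulmxA.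
Qed.

Let continuous_sumf (T : topologicalType) n (f : 'I_n -> T -> R) :
  (forall i, continuous (f i)) -> continuous (fun x => \sum_i f i x).
Proof.
elim: n f => [|n IH] f cf.
  by under eq_fun do rewrite big_ord0; exact: cst_continuous.
under eq_fun do rewrite big_ord_recl.
by move=> x; apply: continuousD; [exact: cf|apply: IH => i; exact: cf].
Qed.

Let continuous_sqr (T : topologicalType) (f : T -> R) :
  continuous f -> continuous (fun x => f x * f x).
Proof. by move=> cf x; apply: continuousM; exact: cf. Qed.

Lemma projection_ex : exists2 B, K B & forall C, K C ->
  \tr ((B - a)^T *m (B - a)) <= \tr ((C - a)^T *m (C - a)).
Proof.
pose g (v : 'rV[R]_(d * d)) := \tr ((vec_mx v - a)^T *m (vec_mx v - a)).
have cg : continuous g.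
  rewrite /g; under eq_fun do rewrite frobE.
  apply: continuous_sumf => j; apply: continuous_sumf => i.
  apply: continuous_sqr; under eq_fun do rewrite !mxE.
  move=> v; apply: continuousB; last exact: cst_continuous.
  exact: (@coord_continuous R 1 (d * d)).
have clK : closed [set v | K (vec_mx v)].
  have -> : [set v | K (vec_mx v)] = \bigcap_(u : 'cV[R]_d)
      (fun v : 'rV[R]_(d * d) => (((vec_mx v)^T *m u)^T *m ((vec_mx v)^T *m u)) 0 0)
        @^-1` [set x | x <= (u^T *m S *m u) 0 0].
    by apply/seteqP; split => v /= => [/KP h u _|h]; [exact: h|apply/KP => u; exact: h].
  apply: closed_bigI => u _; apply: closed_comp; last exact: closed_le.
  move=> v _; move: v; under eq_fun do rewrite dotE.
  apply: continuous_sumf => j; under eq_fun do rewrite expr2.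
  apply: continuous_sqr; under eq_fun do rewrite mxE.
  apply: continuous_sumf => i; under eq_fun do rewrite !mxE.
  move=> v; apply: continuousM; last exact: cst_continuous.
  exact: (@coord_continuous R 1 (d * d)).
(* Testing at basis vectors bounds each row of [B] by a diagonal entry of [S], so every entry
   satisfies [x^2 <= tr S]; the bound [|x| <= 1 + tr S] avoids a square root. *)
pose M := 1 + \tr S.
have compK : compact [set v | K (vec_mx v)].
  have Mco := @rV_compact R (d * d) (fun=> `[- M, M]%classic)
    (fun=> @segment_compact _ _ _).
  apply: subclosed_compact clK Mco _ => v /KP Kv k.
  have [i [j ->]] : exists i j, k = mxvec_index i j.
    by case/mxvec_indexP: k => i j; exists i, j.
  have vE : v ord0 (mxvec_index i j) = vec_mx v i j by rewrite mxE.
  rewrite vE /= in_itv /= -ler_norml.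
  have S0 l : 0 <= S l l.
    have /covarianceP[_ /(_ (delta_mx l 0))] := covS.
    by rewrite -mulmxA -colE trmx_delta -rowE !mxE.
  have h : vec_mx v i j ^+ 2 <= \tr S.
    have := Kv (delta_mx i 0); rewrite -mulmxA -colE trmx_delta -rowE dotE.
    rewrite (bigD1 j)//= => h.
    apply: (@le_trans _ _ (S i i)); last first.
      by rewrite /mxtrace (bigD1 i)//= lerDl sumr_ge0.
    apply: le_trans (le_trans h _); last by rewrite mxE -colE mxE.
    rewrite (_ : vec_mx v i j = col i (vec_mx v)^T j 0); last by rewrite !mxE.
    rewrite lerDl sumr_ge0// => ? _; exact: sqr_ge0.
  rewrite -(@ler_pXn2r _ 2) ?nnegrE//; last first.
    by rewrite addr_ge0// (le_trans _ h)// sqr_ge0.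
  have tr0 : 0 <= \tr S by rewrite (le_trans _ h)// sqr_ge0.
  rewrite real_normK ?num_real// (le_trans h)// /M.
  by nra.
have K0 : [set v | K (vec_mx v)] !=set0.
  exists 0; apply/KP => u; rewrite linear0 trmx0 mul0mx mulmx0 mxE.
  by have /covarianceP[_] := covS; exact.
have [v Kv minv] := EVT_min_rV K0 compK (continuous_subspaceT cg).
exists (vec_mx v); first by rewrite inE in Kv.
move=> C KC; have := minv (mxvec C); rewrite /g mxvecK; apply.
by rewrite inE /= mxvecK.
Qed.

Lemma projection_convex B C (t : R) : 0 <= t <= 1 -> K B -> K C ->
  K (B + t *: (C - B)).
Proof.
move=> /andP[t0 t1] /KP KB /KP KC; apply/KP => u.
have := KB u; have := KC u; have := dot_ge0 ((C - B)^T *m u).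
rewrite !dotE => h1 h2 h3.
set p := B^T *m u in h3; set q := C^T *m u in h2.
have E1 i : ((C - B)^T *m u) i 0 = q i 0 - p i 0.
  by rewrite linearB /= mulmxBl !mxE.
have E2 i : ((B + t *: (C - B))^T *m u) i 0 = p i 0 + t * (q i 0 - p i 0).
  by rewrite linearD linearZ /= mulmxDl -scalemxAl mxE [X in _ + X]mxE E1.
under eq_bigr do rewrite E2.
apply: le_trans (_ : (1 - t) * \sum_i p i 0 ^+ 2 + t * \sum_i q i 0 ^+ 2 <= _).
  rewrite !mulr_sumr -big_split /=; apply: ler_sum => i _.
  have := sqr_ge0 (p i 0 - q i 0); set x := p i 0; set y := q i 0.
  have t2 : 0 <= t * (1 - t) by rewrite mulr_ge0// subr_ge0.
  by move=> /(mulr_ge0 t2); nra.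
have := ler_wpM2l t0 h2; have := @ler_wpM2l _ (1 - t) _ _ _ h3.
by rewrite subr_ge0 => /(_ t1); lra.
Qed.

Lemma projection_vi : exists2 B, K B & forall C, K C ->
  0 <= \tr ((B - a)^T *m (C - B)).
Proof.
have [B KB minB] := projection_ex; exists B => // C KC.
rewrite leNgt; apply/negP => lt0.
set x := \tr ((B - a)^T *m (C - B)) in lt0.
set y := \tr ((C - B)^T *m (C - B)).
have y0 : 0 <= y by exact: frob_ge0.
(* A step [t] towards [C] changes the squared distance by [t (2 x + t y)]. This [t] satisfies
   [t y = t x - x], so the change is [t x (1 + t) < 0]; the divisor [y - x] is positive even when
   [y = 0]. *)
pose t := - x / (y - x).
have xy : 0 < y - x by lra.
have t0 : 0 < t by rewrite divr_gt0// oppr_gt0.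
have t1 : t <= 1 by rewrite ler_pdivrMr// mul1r; lra.
have := minB _ (projection_convex (t := t) _ KB KC).
rewrite ltW// t1 => /(_ isT).
rewrite addrAC [leRHS]frobD leNgt => /negP; apply.
rewrite -addrA gtrDl [(t *: _)^T]linearZ /= -scalemxAl -!scalemxAr !mxtraceZ.
rewrite -/x -/y (mulrCA 2) -mulrDr pmulr_rlt0//.
have : t * (y - x) = - x by rewrite /t divfK// gt_eqF.
by nra.
Qed.

End projection.

Section backward_matrix.
Context {R : realType} {d : nat}.

(** Pythagoras: [|w - p w|^2 = |w|^2 - |p w|^2]. *)
Lemma projector_dot_le (p : 'M[R]_d) (w : 'cV_d) : p^T = p -> p *m p = p ->
  ((p *m w)^T *m (p *m w)) 0 0 <= (w^T *m w) 0 0.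
Proof.
move=> symp pp; have := dot_ge0 (w - p *m w).
rewrite [(w - _)^T]raddfB /= mulmxBl !mulmxBr !trmx_mul symp !mulmxA.
rewrite -!(mulmxA w^T) pp !mulmxA !mxE; lra.
Qed.

(* C is the linear part of the optimal map X |-> m_nu + C (X - m_mu); T and L
   stand for the covariance of a competitor Y, and for that of Y and X. *)
Lemma backward_matrix (a S : 'M[R]_d) : a^T = a -> is_covariance S ->
  exists B C : 'M[R]_d, [/\ cov_le (B *m B^T) S, C *m a = B,
    (forall B' : 'M[R]_d, cov_le (B' *m B'^T) S ->
      \tr ((B - a)^T *m (B - a)) + \tr ((B' - B)^T *m (B' - B)) <=
      \tr ((B' - a)^T *m (B' - a))) &
    (forall T L : 'M[R]_d,
      (forall u v : 'cV[R]_d, 0 <= (u^T *m T *m u) 0 0 +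
         2 * (u^T *m L *m v) 0 0 + (v^T *m (a *m a) *m v) 0 0) ->
      (forall u : 'cV[R]_d, (u^T *m T *m u) 0 0 <= (u^T *m S *m u) 0 0) ->
      0 <= \tr ((C - 1%:M)^T *m (L - C *m (a *m a))))].
Proof.
move=> syma covS.
have [B KB vi] := projection_vi a covS.
have [b [symb ab aba bab]] := sym_pinv syma.
(* The orthogonal projector on the range of [a]; [1 - p] projects on its kernel. *)
pose p := a *m b.
have symp : p^T = p by rewrite trmx_mul syma symb -ab.
have pp : p *m p = p by rewrite /p !mulmxA aba.
have symS := covariance_sym covS.
have KP (B' : 'M[R]_d) : cov_le (B' *m B'^T) S <-> forall u : 'cV[R]_d,
    ((B'^T *m u)^T *m (B'^T *m u)) 0 0 <= (u^T *m S *m u) 0 0.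
  rewrite cov_leP//; last by rewrite trmx_mul trmxK.
  by split=> h u; have := h u; rewrite trmx_mul trmxK !mulmxA.
(* [B p] is admissible, and [B p - a] is orthogonal to [B - B p] since [a = a p]. The variational
   inequality against [B p] thus reads [- |B - B p|^2 >= 0]. This is what lets [C = B b] solve
   [C a = B]. *)
have Bp : B *m p = B.
  have KBp : cov_le ((B *m p) *m (B *m p)^T) S.
    apply/KP => u; rewrite [(B *m p)^T]trmx_mul symp -(mulmxA p).
    apply: (@le_trans _ _ (((B^T *m u)^T *m (B^T *m u)) 0 0)).
    exact: projector_dot_le.
  by have /KP := KB; exact.
  apply/esym/subr0_eq/frob_eq0/eqP; rewrite eq_le frob_ge0 andbT.
  have := vi _ KBp.
  have -> : B - a = (B *m p - a) + (B - B *m p) by rewrite [RHS]addrC addrA subrK.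
  rewrite [(_ + _)^T]raddfD /= mulmxDl mxtraceD -[B *m p - B]opprB !mulmxN.
  rewrite !raddfN /=.
  have -> : \tr ((B *m p - a)^T *m (B - B *m p)) = 0.
    have {1}-> : B *m p - a = (B *m p - a) *m p.
      by rewrite mulmxBl -mulmxA pp; congr (_ - _); rewrite /p ab mulmxA aba.
    rewrite trmx_mul symp -mulmxA mxtrace_mulC -mulmxA mulmxBl -mulmxA pp subrr.
    by rewrite mulmx0 mxtrace0.
  by rewrite oppr0 add0r oppr_ge0.
have Ca : B *m b *m a = B by rewrite -mulmxA -ab.
exists B, (B *m b); split => // [B' KB'|T L psd TS].
  have -> : B' - a = (B - a) + (B' - B) by rewrite [RHS]addrC addrA subrK.
  by rewrite [leRHS]frobD lerDl mulr_ge0// vi.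
have aap : a *m a *m (1%:M - p) = 0.
  by rewrite mulmxBr mulmx1 -mulmxA /p ab (mulmxA a b) aba subrr.
(* For [v] in the kernel of [a], the nonnegative form is affine in the scale of [v]; its slope, an
   entry of [L (1 - p)], must vanish. *)
have Lp : L *m p = L.
  apply/esym/subr0_eq; rewrite -[X in X - _]mulmx1 -mulmxBr.
  apply/matrixP => i j; rewrite [RHS]mxE.
  pose u : 'cV[R]_d := delta_mx i 0; pose v : 'cV[R]_d := (1%:M - p) *m delta_mx j 0.
  have -> : (L *m (1%:M - p)) i j = (u^T *m L *m v) 0 0.
    by rewrite /u trmx_delta /v !mulmxA -colE -mulmxA -rowE !mxE.
  set x := _ 0 0.
  have sc1 (c : R) (M : 'M[R]_1) : (c *: M) 0 0 = c * M 0 0 by rewrite mxE.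
  have h t : 0 <= (u^T *m T *m u) 0 0 + t * x.
    have := psd u ((t / 2) *: v).
    have -> : ((t / 2) *: v)^T *m (a *m a) *m ((t / 2) *: v) = 0.
      by rewrite -scalemxAr /v -mulmxA (mulmxA (a *m a)) aap mul0mx mulmx0 scaler0.
    rewrite -scalemxAr sc1 [X in _ + X]mxE addr0 -/x.
    by rewrite mulrA (mulrC 2) divfK.
  apply/eqP; apply/negPn/negP => x0.
  have := h (- ((u^T *m T *m u) 0 0 + 1) / x); rewrite divfK//; lra.
(* Here [L = B' a], and the choice [v = - b w] with [w = B'^T u] turns positivity into the Schur
   complement bound [|B'^T u|^2 <= u^T T u]. So [B'] is admissible, and the claim is the variational
   inequality at [B'], because [L - C a a = (B' - B) a]. *)
pose B' := L *m b.
have KB' : cov_le (B' *m B'^T) S.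
  apply/KP => u; set w := B'^T *m u.
  have := psd u (- (b *m w)); have := TS u.
  have -> : u^T *m L *m (- (b *m w)) = - (w^T *m w).
    by rewrite mulmxN /w [in RHS]trmx_mul trmxK /B' !mulmxA.
  have pb : p *m b = b by rewrite /p ab bab.
  have -> : (- (b *m w))^T *m (a *m a) *m (- (b *m w)) = w^T *m w.
    rewrite mulmxN [(- _)^T]raddfN /= !mulNmx opprK trmx_mul symb.
    have -> : w^T *m b *m (a *m a) *m (b *m w) = w^T *m (p *m (p *m w)).
      by rewrite {1}/p ab /p !mulmxA.
    have pw : p *m w = w by rewrite /w /B' trmx_mul symb !mulmxA pb.
    by rewrite !pw.
  have -> (M : 'M[R]_1) : (- M) 0 0 = - M 0 0 by rewrite mxE.
  by lra.
have La : L = B' *m a by rewrite /B' -mulmxA -ab Lp.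
rewrite {1}La mulmxA Ca -mulmxBl mulmxA mxtrace_mulC -{1}syma mulmxA -trmx_mul.
by rewrite mulmxBl mul1mx Ca; exact: vi.
Qed.

End backward_matrix.

(** * Rotation invariance of Gaussian laws *)

Section normal_integral.
Context {R : realType}.
Local Notation leb := (@lebesgue_measure R).
Local Notation TR := (measurableTypeR R).
Local Open Scope ereal_scope.

(** [normal_pdf] and the Radon-Nikodym derivative have the same integral on every measurable set,
    hence agree almost everywhere. *)
Lemma integral_normal_prob (f : TR -> \bar R) :
  measurable_fun setT f -> (forall x, 0 <= f x) ->
  \int[normal_prob 0 1]_x f x = \int[leb]_x (f x * (normal_pdf 0 1 x)%:E).
Proof.
move=> mf f0.
have dom := @normal_prob_dominates R 0 1.
rewrite -(Radon_Nikodym_SigmaFinite.change_of_variables dom)//=.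
have mRN := Radon_Nikodym_SigmaFinite.f_integrable dom.
have mpdf := @integrable_normal_pdf R 0 1.
apply: ae_eq_integral => //=.
- by apply: emeasurable_funM => //; exact: measurable_int mRN.
- by apply: emeasurable_funM => //; exact: measurable_int mpdf.
apply: ae_eqe_mul2l; apply: integral_ae_eq => //=.
- exact: measurable_int mpdf.
- by move=> E _ mE; rewrite -Radon_Nikodym_SigmaFinite.f_integral.
Qed.

(** The image of Lebesgue measure under a translation gives every interval its length, and
    uniqueness identifies it with Lebesgue measure. *)
Lemma ge0_integral_translate (f : TR -> \bar R) (t : R) :
  measurable_fun setT f -> (forall x, 0 <= f x) ->
  \int[leb]_x f (x + t)%R = \int[leb]_x f x.
Proof.
move=> mf f0.
have mt : measurable_fun setT (fun x : TR => (x + t)%R : TR).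
  exact: measurable_funD.
transitivity (\int[pushforward leb (fun x : TR => (x + t)%R : TR)]_x f x).
  by rewrite ge0_integral_pushforward//= preimage_setT.
apply: eq_measure_integral => A mA _.
apply/esym/lebesgue_measure_unique => //= _ [[a b]] _ <-.
rewrite /pushforward.
rewrite (_ : _ @^-1` _ = [set` `](a - t)%R, (b - t)%R]%R]); last first.
  by apply/seteqP; split => x /=; rewrite !in_itv/= ltrBlDr lerBrDr.
by rewrite !lebesgue_measure_itv/= !lte_fin ltrD2r -!EFinD opprB addrA subrK.
Qed.

Let dbl (g : TR * TR -> \bar R) := \int[leb]_x \int[leb]_y g (x, y).

Let dbl_shear2 (g : TR * TR -> \bar R) (t : R) :
  measurable_fun setT g -> (forall z, 0 <= g z) ->
  dbl (fun z => g (z.1, z.2 + t * z.1)%R) = dbl g.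
Proof.
move=> mg g0; apply: eq_integral => x _ /=.
rewrite (ge0_integral_translate (f := fun y => g (x, y)))//.
by apply: measurableT_comp => //; exact: measurable_pair1.
Qed.

Let dbl_shear1 (g : TR * TR -> \bar R) (t : R) :
  measurable_fun setT g -> (forall z, 0 <= g z) ->
  dbl (fun z => g (z.1 + t * z.2, z.2)%R) = dbl g.
Proof.
move=> mg g0; rewrite /dbl.
have ms : measurable_fun setT (fun z : TR * TR => (z.1 + t * z.2, z.2)%R : TR * TR).
  apply/measurable_fun_pairP; split => /=; last exact: measurable_snd.
  apply: measurable_funD; first exact: measurable_fst.
  by apply: measurable_funM => //; exact: measurable_snd.
have mgs := measurableT_comp mg ms.
have E1 := fubini_tonelli (m1 := leb) (m2 := leb) _ mgs (fun z => g0 _).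
have E2 := fubini_tonelli (m1 := leb) (m2 := leb) _ mg g0.
apply: etrans (etrans E1 _) (esym E2).
apply: eq_integral => y _ /=.
rewrite (ge0_integral_translate (f := fun x => g (x, y)))//.
by apply: measurableT_comp => //; exact: measurable_pair2.
Qed.

(* A plane rotation of angle other than pi is a product of three shears, with
   -tan (theta / 2) = - s / (1 + c) as the parameter of the outer ones. *)
Let dbl_rotation (g : TR * TR -> \bar R) (c s : R) :
  (c ^+ 2 + s ^+ 2 = 1)%R -> c != (-1)%R ->
  measurable_fun setT g -> (forall z, 0 <= g z) ->
  dbl (fun z => g (c * z.1 - s * z.2, s * z.1 + c * z.2)%R) = dbl g.
Proof.
move=> cs c1 mg g0; pose t := (- (s / (1 + c)))%R.
have c10 : (1 + c != 0)%R by rewrite addrC addr_eq0.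
have mX (h : TR * TR -> \bar R) u : measurable_fun setT h ->
    measurable_fun setT (fun z : TR * TR => h (z.1 + u * z.2, z.2)%R).
  move=> mh; apply: (measurableT_comp mh); apply/measurable_fun_pairP.
  split => /=; last exact: measurable_snd.
  apply: measurable_funD; first exact: measurable_fst.
  by apply: measurable_funM => //; exact: measurable_snd.
have mY (h : TR * TR -> \bar R) u : measurable_fun setT h ->
    measurable_fun setT (fun z : TR * TR => h (z.1, z.2 + u * z.1)%R).
  move=> mh; apply: (measurableT_comp mh); apply/measurable_fun_pairP.
  split => /=; first exact: measurable_fst.
  apply: measurable_funD; first exact: measurable_snd.
  by apply: measurable_funM => //; exact: measurable_fst.
have E1 := dbl_shear1 t mg g0.
have E2 := dbl_shear2 s (mX _ t mg) (fun z => g0 _).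
have E3 := dbl_shear1 t (mY _ s (mX _ t mg)) (fun z => g0 _).
apply: etrans _ (etrans E3 (etrans E2 E1)).
rewrite /dbl; apply: eq_integral => x _; apply: eq_integral => y _ /=.
have st : (s * t = c - 1)%R.
  rewrite /t mulrN mulrA -expr2; apply/(mulIf c10); rewrite mulNr divfK//.
  by have := cs; lra.
have tc : (t * (1 + c) = - s)%R by rewrite /t mulNr divfK.
congr (g (_, _))%R.
  have -> : (x + t * y + t * (y + s * (x + t * y)) =
    (1 + s * t) * x + (t * (2 + s * t)) * y)%R by ring.
  by rewrite st [(2 + _)%R](_ : _ = 1 + c)%R ?tc; ring.
have -> : (y + s * (x + t * y) = s * x + (1 + s * t) * y)%R by ring.
by rewrite st; ring.
Qed.

Let normal_pdf2_rotation (c s x y : R) : (c ^+ 2 + s ^+ 2 = 1)%R ->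
  (normal_pdf 0 1 (c * x - s * y) * normal_pdf 0 1 (s * x + c * y) =
   normal_pdf 0 1 x * normal_pdf 0 1 y)%R.
Proof.
move=> cs; rewrite !normal_pdfE ?oner_neq0// /normal_fun.
rewrite mulrACA [RHS]mulrACA -!expRD !subr0; congr (_ * expR _)%R.
rewrite -!mulrDl -!opprD; congr (- _ / _)%R.
transitivity ((c ^+ 2 + s ^+ 2) * (x ^+ 2 + y ^+ 2))%R; first by ring.
by rewrite cs mul1r.
Qed.

Let dbl_normalE (g : TR * TR -> \bar R) :
  measurable_fun setT g -> (forall z, 0 <= g z) ->
  \int[normal_prob 0 1]_x \int[normal_prob 0 1]_y g (x, y) =
  dbl (fun z => g z * (normal_pdf 0 1 z.1 * normal_pdf 0 1 z.2)%:E).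
Proof.
move=> mg g0; have mN := @measurable_normal_pdf R 0 1.
have N0 := @normal_pdf_ge0 R 0 1.
rewrite integral_normal_prob; last 2 first.
- exact: (measurable_fun_fubini_tonelli_F (m2 := normal_prob 0 1) g).
- by move=> x; exact: integral_ge0.
apply: eq_integral => x _; rewrite integral_normal_prob//; last first.
  by apply: measurableT_comp => //; exact: measurable_pair1.
rewrite -ge0_integralZr//=.
- by apply: eq_integral => y _; rewrite -muleA -EFinM mulrC.
- apply: emeasurable_funM; last exact/measurable_EFinP.
  by apply: measurableT_comp => //; exact: measurable_pair1.
- by move=> y _; rewrite mule_ge0// lee_fin.
- by rewrite lee_fin.
Qed.

(** Products of shears preserve plane Lebesgue measure, and the product of two standard densities
    depends on [x^2 + y^2] only. *)
Lemma normal_prob_rotation (g : TR * TR -> \bar R) (c s : R) :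
  (c ^+ 2 + s ^+ 2 = 1)%R -> measurable_fun setT g -> (forall z, 0 <= g z) ->
  \int[normal_prob 0 1]_x \int[normal_prob 0 1]_y
    g (c * x - s * y, s * x + c * y)%R =
  \int[normal_prob 0 1]_x \int[normal_prob 0 1]_y g (x, y).
Proof.
have mrot (h : TR * TR -> \bar R) p q : measurable_fun setT h ->
    measurable_fun setT (fun z : TR * TR => h (p * z.1 - q * z.2, q * z.1 + p * z.2)%R).
  move=> mh; apply: (measurableT_comp mh); apply/measurable_fun_pairP.
  by split => /=; [apply: measurable_funB|apply: measurable_funD];
    apply: measurable_funM => //; (exact: measurable_fst || exact: measurable_snd).
have mN := @measurable_normal_pdf R 0 1.
have main (h : TR * TR -> \bar R) p q : (p ^+ 2 + q ^+ 2 = 1)%R -> p != (-1)%R ->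
    measurable_fun setT h -> (forall z, 0 <= h z) ->
    \int[normal_prob 0 1]_x \int[normal_prob 0 1]_y
      h (p * x - q * y, q * x + p * y)%R =
    \int[normal_prob 0 1]_x \int[normal_prob 0 1]_y h (x, y).
  move=> pq p1 mh h0.
  have F1 := dbl_normalE (mrot _ p q mh) (fun z => h0 _).
  have F2 := dbl_normalE mh h0.
  apply: etrans F1 (etrans _ (esym F2)).
  have mhN : measurable_fun setT (fun z : TR * TR =>
      h z * (normal_pdf 0 1 z.1 * normal_pdf 0 1 z.2)%:E).
    apply: emeasurable_funM => //; apply/measurable_EFinP; apply: measurable_funM.
      by apply: measurableT_comp => //; exact: measurable_fst.
    by apply: measurableT_comp => //; exact: measurable_snd.
  have hN0 z : 0 <= h z * (normal_pdf 0 1 z.1 * normal_pdf 0 1 z.2)%:E.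
    by rewrite mule_ge0// lee_fin mulr_ge0// normal_pdf_ge0.
  have F3 := dbl_rotation pq p1 mhN hN0.
  apply: etrans _ F3.
  apply: eq_integral => x _; apply: eq_integral => y _ /=.
  by congr (_ * _%:E); exact/esym/normal_pdf2_rotation.
(* The shear decomposition excludes the half-turn, which is obtained as two quarter turns ([c = 0],
   [s = 1]). *)
move=> cs mg g0; have [c1|] := eqVneq c (-1)%R; last by move=> c1; exact: (main _ _ _ cs c1 mg g0).
have s0 : s = 0%R.
  by apply/eqP; rewrite -sqrf_eq0; apply/eqP; move: cs; rewrite c1; lra.
have n01 : (0 != -1 :> R)%R by rewrite eq_sym oppr_eq0 oner_neq0.
have e01 : (0 ^+ 2 + 1 ^+ 2 = 1 :> R)%R by rewrite expr0n expr1n add0r.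
have H1 := main g 0%R 1%R e01 n01 mg g0.
have H2 := main _ 0%R 1%R e01 n01 (mrot _ 0%R 1%R mg) (fun z => g0 _).
apply: etrans _ (etrans H2 H1).
apply: eq_integral => x _; apply: eq_integral => y _ /=.
by congr (g (_, _)); rewrite s0 c1; ring.
Qed.

End normal_integral.

Section std_gaussian_invariance.
Context {R : realType}.
Local Notation TR := (measurableTypeR R).
Local Open Scope ereal_scope.

Lemma measurable_mulmx n k (A : 'M[R]_(k, n)) :
  measurable_fun setT (fun z : 'cV[R]_n => A *m z).
Proof.
apply/measurable_fun_cVP => i.
under eq_fun do rewrite mxE.
apply: measurable_sum => j; apply: measurable_funM => //.
exact: measurable_coord.
Qed.

Lemma integral_std_gaussianS n (f : 'cV[R]_n.+1 -> \bar R) :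
  measurable_fun setT f -> (forall z, 0 <= f z) ->
  \int[std_gaussian n.+1]_z f z =
  \int[normal_prob 0 1]_x \int[std_gaussian n]_v f (cons_cV (x, v)).
Proof.
move=> mf f0 /=.
have mfc : measurable_fun setT (f \o @cons_cV R n).
  exact: (measurableT_comp mf (@measurable_cons_cV R n)).
have E1 := fubini_tonelli1 (m1 := normal_prob 0 1) (m2 := std_gaussian n)
  _ mfc (fun z => f0 _).
apply: etrans _ E1.
by rewrite ge0_integral_pushforward//= preimage_setT.
Qed.

Lemma integral_std_gaussian0 (f : 'cV[R]_0 -> \bar R) :
  measurable_fun setT f -> \int[std_gaussian 0]_z f z = f 0%R.
Proof. by move=> mf; rewrite /= integral_dirac// diracT mul1e. Qed.

Let measurable_cons2 n (x : R) :
  measurable_fun setT (fun v : 'cV[R]_n => cons_cV (x : TR, v)).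
Proof.
apply: (measurableT_comp (@measurable_cons_cV R n)).
exact: measurable_pair1.
Qed.

(** The half-turn of the plane, applied to a function of the first coordinate alone. *)
Let integral_normal_probN (g : TR -> \bar R) :
  measurable_fun setT g -> (forall x, 0 <= g x) ->
  \int[normal_prob 0 1]_x g (- x)%R = \int[normal_prob 0 1]_x g x.
Proof.
move=> mg g0.
have mg1 : measurable_fun setT (fun z : TR * TR => g z.1).
  by apply: measurableT_comp => //; exact: measurable_fst.
have e01 : ((-1) ^+ 2 + 0 ^+ 2 = 1 :> R)%R by rewrite expr0n sqrrN expr1n addr0.
have := normal_prob_rotation e01 mg1 (fun z => g0 _).
have E x : \int[normal_prob 0 1]_y g x = g x.
  by rewrite integral_cst//= probability_setT mule1.
under [RHS]eq_integral do rewrite E.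
move=> <-; apply: eq_integral => x _.
by rewrite -[LHS]E; apply: eq_integral => y _ /=; rewrite mulN1r mul0r subr0.
Qed.

(** Tonelli splits the leading coordinates off the recursive definition of the law: a lift acts on
    the remaining ones, a flip uses the symmetry of one normal variable, and a plane rotation the
    invariance for two. *)
Lemma std_gaussian_rotation n (U : 'M[R]_n) : rotation U ->
  forall f : 'cV[R]_n -> \bar R, measurable_fun setT f -> (forall z, 0 <= f z) ->
  \int[std_gaussian n]_z f (U *m z) = \int[std_gaussian n]_z f z.
Proof.
elim=> {n U} [n|n U V _ IU _ IV|n U _ IU|n|n c s cs] f mf f0.
- by apply: eq_integral => z _; rewrite mul1mx.
- rewrite -(IU _ mf f0) -[RHS](IV (fun z => f (U *m z)))//.
    by apply: eq_integral => z _; rewrite mulmxA.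
  exact: (measurableT_comp mf (measurable_mulmx U)).
- have mfU := measurableT_comp mf (measurable_mulmx (block_mx 1%:M 0 0 U)).
  have E1 := integral_std_gaussianS mfU (fun z => f0 _).
  have E2 := integral_std_gaussianS mf f0.
  apply: etrans E1 (etrans _ (esym E2)).
  apply: eq_integral => x _.
  have mfx := measurableT_comp mf (measurable_cons2 x).
  apply: etrans _ (IU _ mfx (fun v => f0 _)).
  apply: eq_integral => v _; congr f.
  by rewrite /cons_cV mul_block_col !mul0mx addr0 add0r mul1mx.
- have mfU := measurableT_comp mf
    (measurable_mulmx (block_mx (- 1)%:M 0 0 1%:M : 'M[R]_(1 + n))).
  have E1 := integral_std_gaussianS mfU (fun z => f0 _).
  have E2 := integral_std_gaussianS mf f0.
  have mF := measurable_fun_fubini_tonelli_F (m2 := std_gaussian n)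
    (fun z => f (cons_cV z)) (measurableT_comp mf (@measurable_cons_cV R n))
    (fun z => f0 _).
  have F0 x : 0 <= fubini_F (std_gaussian n) (fun z => f (cons_cV z)) x.
    by apply: integral_ge0.
  apply: etrans E1 (etrans _ (esym E2)).
  apply: etrans _ (integral_normal_probN mF F0).
  apply: eq_integral => x _; apply: eq_integral => v _; congr f.
  rewrite /cons_cV mul_block_col !mul0mx addr0 add0r mul1mx.
  by rewrite -scalar_mxM mulN1r.
- pose g (z : TR * TR) := \int[std_gaussian n]_v f (cons_cV (z.1, cons_cV (z.2, v))).
  have mcc : measurable_fun setT (fun z : (TR * TR) * 'cV[R]_n =>
      cons_cV (z.1.1, cons_cV (z.1.2, z.2))).
    apply: (measurableT_comp (@measurable_cons_cV R n.+1)).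
    apply/measurable_fun_pairP; split => /=.
      exact: (measurableT_comp measurable_fst measurable_fst).
    apply: (measurableT_comp (@measurable_cons_cV R n)).
    apply/measurable_fun_pairP; split => /=; last exact: measurable_snd.
    exact: (measurableT_comp measurable_snd measurable_fst).
  have mg : measurable_fun setT g.
    apply: (measurable_fun_fubini_tonelli_F (m2 := std_gaussian n)
      (fun z => f (cons_cV (z.1.1, cons_cV (z.1.2, z.2))))) => //.
    exact: (measurableT_comp mf mcc).
  have g0 z : 0 <= g z by exact: integral_ge0.
  have E (h : 'cV[R]_(1 + (1 + n)) -> \bar R) : measurable_fun setT h ->
      (forall z, 0 <= h z) -> \int[std_gaussian (1 + (1 + n))]_z h z =
      \int[normal_prob 0 1]_x \int[normal_prob 0 1]_y \int[std_gaussian n]_v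
        h (cons_cV (x, cons_cV (y, v))).
    move=> mh h0; apply: etrans (integral_std_gaussianS mh h0) _.
    apply: eq_integral => x _.
    have mhx := measurableT_comp mh (measurable_cons2 x).
    exact: (integral_std_gaussianS mhx (fun z => h0 _)).
  have mfU := measurableT_comp mf (measurable_mulmx (block_mx c%:M
    (row_mx (- s)%:M 0) (col_mx s%:M 0) (block_mx c%:M 0 0 1%:M) : 'M[R]_(1 + (1 + n)))).
  apply: etrans (E _ mfU (fun z => f0 _)) (etrans _ (esym (E _ mf f0))).
  apply: etrans _ (normal_prob_rotation cs mg g0).
  apply: eq_integral => x _; apply: eq_integral => y _.
  apply: eq_integral => v _; congr f; rewrite /cons_cV /=.
  rewrite mul_block_col mul_row_col mul_block_col mul_col_mx !mul0mx.
  rewrite !addr0 add0r mul1mx add_col_mx add0r -!scalar_mxM -!raddfD /=.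
  by rewrite mulNr.
Qed.

Lemma std_gaussian_dsubmx k n (f : 'cV[R]_n -> \bar R) :
  measurable_fun setT f -> (forall z, 0 <= f z) ->
  \int[std_gaussian (k + n)]_z f (dsubmx z) = \int[std_gaussian n]_z f z.
Proof.
move=> mf f0; have md m : measurable_fun setT (fun z : 'cV[R]_(m + n) => dsubmx z).
  apply/measurable_fun_cVP => i; under eq_fun do rewrite mxE.
  exact: measurable_coord.
elim: k => [|k IH].
  apply: eq_integral => z _; congr f; apply/colP => i; rewrite mxE.
  by congr (z _ _); exact: val_inj.
have mfd := measurableT_comp mf (md k.+1).
apply: etrans (integral_std_gaussianS mfd (fun z => f0 _)) _.
transitivity (\int[normal_prob 0 1]_x \int[std_gaussian n]_z f z).
  apply: eq_integral => x _; rewrite -IH; apply: eq_integral => v _.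
  congr f; apply/colP => i; rewrite mxE /cons_cV.
  have -> : rshift k.+1 i = rshift 1 (rshift k i) by exact: val_inj.
  by rewrite [RHS]mxE; exact: (@col_mxEd _ 1 (k + n) 1).
by rewrite integral_cst//= probability_setT mule1.
Qed.

(** Zero columns bring [A] and [B] to a common width and change neither [A A^T] nor the law of the
    image. The transposes of the padded matrices then have equal Gram matrices, so they differ by a
    rotation. *)
Theorem std_gaussian_gram d n k (A : 'M[R]_(d, n)) (B : 'M[R]_(d, k))
    (f : 'cV[R]_d -> \bar R) :
  A *m A^T = B *m B^T -> measurable_fun setT f -> (forall z, 0 <= f z) ->
  \int[std_gaussian n]_z f (A *m z) = \int[std_gaussian k]_z f (B *m z).
Proof.
move=> AB mf f0.
(* The cast identifies the widths [k + n] and [n + k] of the two paddings. *)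
have pad p q N (e : (p + q)%N = N) (C : 'M[R]_(d, q)) :
    \int[std_gaussian N]_z f (castmx (erefl, e) (row_mx 0 C) *m z) =
    \int[std_gaussian q]_z f (C *m z).
  case: N / e; rewrite castmx_id.
  have mfC := measurableT_comp mf (measurable_mulmx C).
  apply: etrans _ (std_gaussian_dsubmx p mfC (fun z => f0 _)).
  apply: eq_integral => z _; congr f.
  by rewrite -{1}(vsubmxK z) mul_row_col mul0mx add0r.
apply: etrans (esym (pad k n _ erefl A)) _.
apply: etrans _ (pad n k _ (addnC n k) B); rewrite castmx_id.
set A0 := row_mx 0 A; set B0 := castmx _ _.
have [U rU /(congr1 trmx)] : exists2 U, rotation U & A0^T = U *m B0^T.
  apply: gram_rotation; rewrite !trmxK tr_row_mx mul_row_col AB mul0mx add0r.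
  rewrite /B0; case: _ / (addnC n k); rewrite castmx_id tr_row_mx mul_row_col.
  by rewrite mul0mx add0r.
rewrite trmx_mul !trmxK => A0E.
have mfB := measurableT_comp mf (measurable_mulmx B0).
apply: etrans _ (std_gaussian_rotation (rotation_tr rU) mfB (fun z => f0 _)).
by apply: eq_integral => z _; rewrite A0E /= mulmxA.
Qed.

End std_gaussian_invariance.

(** * The second moment of the standard normal law *)

Section normal_second_moment.
Context {R : realType}.
Local Notation leb := (@lebesgue_measure R).
Local Notation TR := (measurableTypeR R).

Let e (x : R) : R := expR (- (x ^+ 2 / 2)).

Let e_ge0 x : 0 <= e x. Proof. exact: expR_ge0. Qed.

Let eE x : normal_pdf 0 1 x = normal_peak 1 * e x.
Proof.
by rewrite normal_pdfE ?oner_neq0// /normal_fun subr0 expr1n mulNr.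
Qed.

Let is_derive_Ne (x : R) : is_derive x 1 (fun t => - e t) (x * e x).
Proof.
have h1 : is_derive x 1 (fun t : R => - (t ^+ 2 / 2)) (- x).
  have : is_derive x 1 (fun t : R => (- 2^-1) *: (id t * id t)) (- x).
    apply: is_derive_eq; rewrite /GRing.scale /= !mulr1.
    by rewrite -mulr2n -[x *+ 2]mulr_natl mulrA mulNr mulVf// mulN1r.
  by congr is_derive; apply/funext => t; rewrite /GRing.scale /= expr2 mulNr mulrC.
have := is_derive1_comp (g := fun t : R => - (t ^+ 2 / 2)) (is_derive_expR _) h1.
move=> /is_deriveN; congr is_derive.
by rewrite mulrN opprK mulrC.
Qed.

Let cvg_e : e x @[x --> +oo] --> (0 : R).
Proof.
apply: (cvg_comp (fun x => x ^+ 2 / 2) (fun x => expR (- x))); last exact: cvgr_expR.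
by apply: gt0_cvgMly => //; exact: cvgr_expr2.
Qed.

Let continuous_e : continuous e.
Proof.
have -> : e = - (fun t => - e t) by apply/funext => t /=; rewrite /GRing.opp /= opprK.
move=> x; apply: continuousN; apply: differentiable_continuous.
by apply: (derivable1_diffP _ _).1; have [] := is_derive_Ne x.
Qed.

(** [- e] is a primitive of [t e(t)] that vanishes at infinity. *)
Let tail (x : R) : 0 <= x ->
  (\int[leb]_(t in `[x, +oo[) (t * e t)%:E = (e x)%:E)%E.
Proof.
move=> x0; rewrite (@ge0_continuous_FTC2y _ _ (fun t => - e t) x 0).
- by rewrite sub0e EFinN oppeK.
- by move=> t xt; rewrite mulr_ge0// (le_trans x0).
- apply: continuous_subspaceT => t.
  by apply: continuousM; [exact: cvg_id|exact: continuous_e].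
- by rewrite -oppr0; exact: cvgN.
- by move=> t _; have [] := is_derive_Ne t.
- by apply: cvgN; apply: cvg_at_right_filter; exact: continuous_e.
- by move=> t _; rewrite derive1E; have [_ ->] := is_derive_Ne t.
Qed.

(* Both sides are the double integral of t e(t) over 0 <= x <= t. *)
Let half_second_moment : (\int[leb]_(t in `[0%R, +oo[) (t ^+ 2 * e t)%:E =
  \int[leb]_(x in `[0%R, +oo[) (e x)%:E)%E.
Proof.
have me : measurable_fun setT e := continuous_measurable_fun continuous_e.
pose A : set (TR * TR) := [set z | 0 <= z.1 /\ z.1 <= z.2].
have mA : measurable A.
  apply: measurableI.
    rewrite -[X in measurable X]setTI.
    by apply: measurable_fun_le => //; exact: measurable_fst.
  rewrite -[X in measurable X]setTI.
  exact: measurable_fun_le.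
(* The absolute value keeps [G] nonnegative everywhere, as Tonelli requires; on [A] it changes
   nothing, since there [0 <= z.1 <= z.2]. *)
pose G (z : TR * TR) : \bar R := (\1_A z * (`|z.2| * e z.2))%:E.
have mG : measurable_fun setT G.
  apply/measurable_EFinP; apply: measurable_funM; first exact: measurable_indic.
  apply: measurable_funM; last by apply: measurableT_comp => //; exact: measurable_snd.
  by apply: measurableT_comp => //; exact: measurable_snd.
have G0 z : (0 <= G z)%E by rewrite lee_fin !mulr_ge0.
have E := fubini_tonelli (m1 := leb) (m2 := leb) _ mG G0.
apply: etrans (esym (etrans E _)) _; clear E.
- rewrite [RHS]integral_mkcond; apply: eq_integral => t _; rewrite patchE.
  case: ifPn; rewrite ?notin_setE ?inE/= in_itv/= andbT => t0.
    transitivity (\int[leb]_(x in `[0%R, t]) cst (t * e t)%:E x)%E.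
      rewrite [RHS]integral_mkcond; apply: eq_integral => x _.
      rewrite /G patchE indicE (ger0_norm t0) mem_setE in_itv/=.
      have [xt|xt] := boolP (0 <= x <= t).
        have -> : ((x, t) \in A) = true by apply/mem_set/andP.
        by rewrite mul1r.
      have -> : ((x, t) \in A) = false by apply/memNset => /andP; exact/negP.
      by rewrite mul0r.
    have tE : leb `[0%R, t]%classic = t%:E.
      rewrite lebesgue_measure_itv/= lte_fin.
      case: ltP => [_|t0']; first by rewrite sube0.
      by congr EFin; apply/eqP; rewrite eq_le t0 t0'.
    rewrite integral_cst; last exact: measurable_itv.
    by rewrite [X in (_ * X)%E]tE -EFinM mulrAC -expr2.
  rewrite -[RHS](integral0 leb setT); apply: eq_integral => x _.
  have xtA : ((x, t) \in A) = false.
    by apply/memNset => -[x0 xt]; exact: t0 (le_trans x0 xt).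
  by rewrite /G indicE xtA mul0r.
- rewrite [RHS]integral_mkcond; apply: eq_integral => x _; rewrite patchE.
  case: ifPn; rewrite ?notin_setE ?inE/= in_itv/= andbT => x0.
    rewrite -(tail x0) [RHS]integral_mkcond; apply: eq_integral => t _.
    rewrite /G patchE indicE.
    case: ifPn; rewrite ?notin_setE ?inE/= in_itv/= andbT => xt.
      have -> : ((x, t) \in A) = true by apply/mem_set; split.
      by rewrite mul1r (ger0_norm (le_trans x0 xt)).
    have -> : ((x, t) \in A) = false by apply/memNset => -[_]; exact: xt.
    by rewrite mul0r.
  rewrite -[RHS](integral0 leb setT); apply: eq_integral => t _.
  have xtA : ((x, t) \in A) = false by apply/memNset => -[x0' _]; exact: x0 x0'.
  by rewrite /G indicE xtA mul0r.
Qed.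

(** By parity, the second moment and the total mass are both [2 * normal_peak 1] times an integral
    on the half-line. These two integrals agree by [half_second_moment], so the total mass gives the
    value. *)
Lemma normal_prob_second_moment :
  (\int[normal_prob 0 1]_x (x ^+ 2)%:E = (1 : R)%:E)%E.
Proof.
rewrite integral_normal_prob; last 2 first.
- by apply/measurable_EFinP; exact: measurable_funX.
- by move=> x; rewrite lee_fin sqr_ge0.
have k0 : 0 <= normal_peak (1 : R) by exact: normal_peak_ge0.
have ce : continuous e := continuous_e.
have N0 x : e (- x) = e x by rewrite /e sqrrN.
have half (f : R -> R) : (forall x, 0 <= f x) -> continuous f -> (forall x, f (- x) = f x) ->
    (\int[leb]_x (normal_peak 1 * f x)%:E =
     (2 * normal_peak 1)%:E * \int[leb]_(x in `[0%R, +oo[) (f x)%:E)%E.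
  move=> f0 cf Nf.
  have mf : measurable_fun setT f := continuous_measurable_fun cf.
  under eq_integral do rewrite EFinM.
  rewrite ge0_integralZl//=; last 2 first.
  - exact/measurable_EFinP.
  - by move=> x _; rewrite lee_fin.
  rewrite ge0_symfun_integralT//; last by move=> x /=; rewrite Nf.
  by rewrite -set_itvcy muleA -EFinM mulrC.
have := @integral_normal_pdf R 0 1.
under eq_integral do rewrite eE.
rewrite half// => <-; rewrite -half_second_moment -(half (fun x => x ^+ 2 * e x)).
- by apply: eq_integral => x _; rewrite eE -EFinM mulrCA.
- by move=> x; rewrite mulr_ge0// sqr_ge0.
- by move=> x; apply: (@continuousM _ _ (fun y : R => y ^+ 2) e); [exact: exprn_continuous|exact: ce].
- by move=> x; rewrite sqrrN N0.
Qed.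

End normal_second_moment.

(** * Second moments *)

Section square_integrable.
Context {R : realType} {disp : measure_display} {T : measurableType disp}.
Variable P : probability T R.

Definition square_integrable (f : T -> R) :=
  measurable_fun setT f /\ P.-integrable setT (fun x => (f x ^+ 2)%:E).

Lemma square_integrableM f g : square_integrable f -> square_integrable g ->
  P.-integrable setT (fun x => (f x * g x)%:E).
Proof.
move=> [mf if2] [mg ig2].
apply: (le_integrable measurableT _ _ (integrableD measurableT if2 ig2)).
  by apply/measurable_EFinP; exact: measurable_funM.
move=> x _; rewrite -EFinD !abse_EFin lee_fin ler_norml ger0_norm; last first.
  by rewrite addr_ge0// sqr_ge0.
have := sqr_ge0 (f x + g x); have := sqr_ge0 (f x - g x).
have := sqr_ge0 (f x); have := sqr_ge0 (g x).
rewrite sqrrB sqrrD; move: (f x ^+ 2) (g x ^+ 2) (f x * g x) => u v p.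
by move=> *; apply/andP; split; lra.
Qed.

Lemma square_integrable_cst c : square_integrable (cst c).
Proof.
split; first exact: measurable_cst.
by apply: (finite_measure_integrable_cst P (c ^+ 2)).
Qed.

Lemma square_integrableD f g : square_integrable f -> square_integrable g ->
  square_integrable (fun x => f x + g x).
Proof.
move=> sf sg; have [mf if2] := sf; have [mg ig2] := sg.
split; first exact: measurable_funD.
have ifg := square_integrableM sf sg.
apply: (eq_integrable measurableT (fun x => (f x ^+ 2)%:E + (g x ^+ 2)%:E +
   ((f x * g x)%:E + (f x * g x)%:E))%E).
  by move=> x _; rewrite -!EFinD; congr EFin; ring.
by apply: integrableD => //; apply: integrableD.
Qed.

Lemma square_integrableZ c f : square_integrable f ->
  square_integrable (fun x => c * f x).
Proof.
move=> [mf if2]; split; first exact: measurable_funM.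
apply: (eq_integrable measurableT (fun x => (c ^+ 2)%:E * (f x ^+ 2)%:E)%E).
  by move=> x _; rewrite -EFinM exprMn.
exact: integrableZl.
Qed.

Lemma square_integrable_sum n (f : 'I_n -> T -> R) :
  (forall i, square_integrable (f i)) ->
  square_integrable (fun x => \sum_i f i x).
Proof.
elim: n f => [|n IH] f sf.
  by under eq_fun do rewrite big_ord0; exact: square_integrable_cst.
under eq_fun do rewrite big_ord_recl.
by apply: square_integrableD => //; apply: IH.
Qed.

Lemma square_integrable_integrable f : square_integrable f ->
  P.-integrable setT (EFin \o f).
Proof.
move=> /(square_integrableM (square_integrable_cst 1)).
by apply: eq_integrable => // x _; rewrite /cst mul1r.
Qed.

End square_integrable.

Section moments.
Context {R : realType} {disp : measure_display} {T : measurableType disp}.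
Variable P : probability T R.
Local Notation sqi := (square_integrable P).

Definition square_integrable_vec n (X : T -> 'cV[R]_n) :=
  forall i, sqi (fun w => X w i ord0).

Local Notation sqv := square_integrable_vec.

(** For centred vectors this is the cross-covariance; with [Y] constant, equal to the 1 by 1
    identity, it is the mean of [X]. The same bilinearity lemmas thus serve for both. *)
Definition moment m n (X : T -> 'cV[R]_m) (Y : T -> 'cV[R]_n) : 'M[R]_(m, n) :=
  \matrix_(i, j) (\int[P]_w (X w i ord0 * Y w j ord0)).

Let mulN1m m n (A : 'M[R]_(m, n)) : (-1)%:M *m A = - A.
Proof. by rewrite mul_scalar_mx scaleN1r. Qed.

Lemma square_integrable_vecD n (X Y : T -> 'cV[R]_n) : sqv X -> sqv Y ->
  sqv (fun w => X w + Y w).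
Proof.
move=> sX sY i; have := square_integrableD (sX i) (sY i).
by congr square_integrable; apply/funext => w; rewrite mxE.
Qed.

Lemma square_integrable_vec_mul m n (A : 'M[R]_(m, n)) (X : T -> 'cV[R]_n) :
  sqv X -> sqv (fun w => A *m X w).
Proof.
move=> sX i; under eq_fun do rewrite mxE.
by apply: square_integrable_sum => j; apply: square_integrableZ; exact: sX.
Qed.

Lemma square_integrable_vecB n (X Y : T -> 'cV[R]_n) : sqv X -> sqv Y ->
  sqv (fun w => X w - Y w).
Proof.
move=> sX sY; under eq_fun do rewrite -mulN1m.
by apply: square_integrable_vecD => //; exact: square_integrable_vec_mul.
Qed.

Lemma square_integrable_vec_cst n (c : 'cV[R]_n) : sqv (fun=> c).
Proof. by move=> i; exact: square_integrable_cst. Qed.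

Lemma moment_tr m n (X : T -> 'cV[R]_m) (Y : T -> 'cV[R]_n) :
  (moment X Y)^T = moment Y X.
Proof.
by apply/matrixP => i j; rewrite !mxE; apply: eq_Rintegral => w _; rewrite mulrC.
Qed.

Lemma momentDl m n (X X' : T -> 'cV[R]_m) (Y : T -> 'cV[R]_n) :
  sqv X -> sqv X' -> sqv Y ->
  moment (fun w => X w + X' w) Y = moment X Y + moment X' Y.
Proof.
move=> sX sX' sY; apply/matrixP => i j; rewrite !mxE -RintegralD//.
- by apply: eq_Rintegral => w _; rewrite mxE mulrDl.
- exact: square_integrableM.
- exact: square_integrableM.
Qed.

Let Rintegral_sum n (f : 'I_n -> T -> R) :
  (forall k, P.-integrable setT (EFin \o f k)) ->
  P.-integrable setT (EFin \o (fun w => \sum_k f k w)) /\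
  \int[P]_w (\sum_k f k w) = \sum_k \int[P]_w f k w.
Proof.
elim: n f => [|n IH] f intf.
  under eq_fun do rewrite big_ord0; rewrite big_ord0 Rintegral_cst// mul0r.
  by split => //; exact: (finite_measure_integrable_cst P 0).
have [i1 i2] := IH (fun k => f (lift ord0 k)) (fun k => intf _).
under eq_fun do rewrite big_ord_recl; rewrite big_ord_recl -i2.
split; last by rewrite RintegralD.
apply: (eq_integrable measurableT (fun w => (f ord0 w)%:E +
  (\sum_(k < n) f (lift ord0 k) w)%:E)%E) => //.
by apply: integrableD => //; exact: intf.
Qed.

Lemma moment_mull m n p (A : 'M[R]_(p, m)) (X : T -> 'cV[R]_m) (Y : T -> 'cV[R]_n) :
  sqv X -> sqv Y -> moment (fun w => A *m X w) Y = A *m moment X Y.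
Proof.
move=> sX sY; apply/matrixP => i j; rewrite !mxE.
under eq_Rintegral do rewrite mxE mulr_suml.
have intXY k : P.-integrable setT (EFin \o (fun w => X w k ord0 * Y w j ord0)).
  exact: square_integrableM.
have intAXY k : P.-integrable setT (EFin \o (fun w => A i k * X w k ord0 * Y w j ord0)).
  apply: (eq_integrable measurableT (fun w => (A i k)%:E * (X w k ord0 * Y w j ord0)%:E)%E).
    by move=> w _; rewrite -EFinM mulrA.
  by apply: integrableZl => //; exact: intXY.
have [_ ->] := Rintegral_sum intAXY.
apply: eq_bigr => k _; rewrite mxE -RintegralZl//.
by apply: eq_Rintegral => w _; rewrite mulrA.
Qed.

Lemma momentBl m n (X X' : T -> 'cV[R]_m) (Y : T -> 'cV[R]_n) :
  sqv X -> sqv X' -> sqv Y ->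
  moment (fun w => X w - X' w) Y = moment X Y - moment X' Y.
Proof.
move=> sX sX' sY; under eq_fun do rewrite -mulN1m.
rewrite momentDl// ?moment_mull ?mulN1m//.
exact: square_integrable_vec_mul.
Qed.

Lemma momentDr m n (X : T -> 'cV[R]_m) (Y Y' : T -> 'cV[R]_n) :
  sqv X -> sqv Y -> sqv Y' ->
  moment X (fun w => Y w + Y' w) = moment X Y + moment X Y'.
Proof.
move=> sX sY sY'; rewrite -[LHS]trmxK moment_tr momentDl// linearD /=.
by rewrite !moment_tr.
Qed.

Lemma momentBr m n (X : T -> 'cV[R]_m) (Y Y' : T -> 'cV[R]_n) :
  sqv X -> sqv Y -> sqv Y' ->
  moment X (fun w => Y w - Y' w) = moment X Y - moment X Y'.
Proof.
move=> sX sY sY'; rewrite -[LHS]trmxK moment_tr momentBl// linearB /=.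
by rewrite !moment_tr.
Qed.

Lemma moment_mulr m n p (A : 'M[R]_(p, n)) (X : T -> 'cV[R]_m) (Y : T -> 'cV[R]_n) :
  sqv X -> sqv Y -> moment X (fun w => A *m Y w) = moment X Y *m A^T.
Proof.
move=> sX sY; rewrite -[LHS]trmxK moment_tr moment_mull// trmx_mul.
by rewrite moment_tr.
Qed.

Lemma moment_ge0 (Z : T -> 'cV[R]_1) : 0 <= moment Z Z 0 0.
Proof. by rewrite mxE; apply: Rintegral_ge0 => w _; rewrite -expr2 sqr_ge0. Qed.

(** This is the second moment of [u . X + v . Y]. It supplies the positivity that [backward_matrix]
    asks of the pair [T], [L]. *)
Lemma moment_form m n (X : T -> 'cV[R]_m) (Y : T -> 'cV[R]_n) (u : 'cV[R]_m)
    (v : 'cV[R]_n) : sqv X -> sqv Y ->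
  0 <= (u^T *m moment X X *m u) 0 0 + 2 * (u^T *m moment X Y *m v) 0 0 +
       (v^T *m moment Y Y *m v) 0 0.
Proof.
move=> sX sY; have := moment_ge0 (fun w => u^T *m X w + v^T *m Y w).
have suX : sqv (fun w => u^T *m X w) by exact: square_integrable_vec_mul.
have svY : sqv (fun w => v^T *m Y w) by exact: square_integrable_vec_mul.
rewrite momentDl ?momentDr//; last exact: square_integrable_vecD.
rewrite !moment_mull// !moment_mulr// !trmxK.
have -> : moment Y X = (moment X Y)^T by rewrite moment_tr.
have -> : v^T *m ((moment X Y)^T *m u) = (u^T *m moment X Y *m v)^T.
  by rewrite !trmx_mul trmxK.
rewrite !mulmxA [X in 0 <= X -> _]mxE [X in 0 <= X + _ -> _]mxE.
rewrite [X in 0 <= _ + X -> _]mxE [((_)^T) 0 0]mxE; lra.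
Qed.

Lemma moment_gram m (X : T -> 'cV[R]_m) (u : 'cV[R]_m) : sqv X ->
  (u^T *m moment X X *m u) 0 0 = \int[P]_w (((u^T *m X w) 0 0) ^+ 2).
Proof.
move=> sX; rewrite -{2}[u]trmxK -mulmxA -moment_mulr// -moment_mull//.
  by rewrite mxE; apply: eq_Rintegral => w _; rewrite expr2.
exact: square_integrable_vec_mul.
Qed.

Lemma enorm_sqr n (v : 'cV[R]_n) : enorm v ^+ 2 = \sum_i v i ord0 ^+ 2.
Proof. by rewrite sqr_sqrtr// sumr_ge0// => i _; rewrite sqr_ge0. Qed.

Lemma integral_enorm_sqr n (X : T -> 'cV[R]_n) : sqv X ->
  (\int[P]_w (enorm (X w) ^+ 2)%:E = (\tr (moment X X))%:E)%E.
Proof.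
move=> sX.
have iX k : P.-integrable setT (EFin \o (fun w => X w k ord0 ^+ 2)) by have [] := sX k.
have [i1 i2] := Rintegral_sum iX.
have -> : \tr (moment X X) = \sum_k \int[P]_w (X w k ord0 ^+ 2).
  by apply: eq_bigr => k _; rewrite mxE; apply: eq_Rintegral => w _; rewrite expr2.
rewrite -i2 /Rintegral fineK; last exact: integrable_fin_num.
by apply: eq_integral => w _; rewrite enorm_sqr.
Qed.

Lemma moment_cst m n (c : 'cV[R]_m) (e : 'cV[R]_n) :
  moment (fun=> c) (fun=> e) = c *m e^T.
Proof.
apply/matrixP => i j; rewrite !mxE big_ord1 Rintegral_cst//.
by rewrite mxE [X in fine X](_ : _ = 1%E) ?mulr1//; exact: probability_setT.
Qed.

End moments.

(** * Laws and moments of affine images of Gaussian vectors *)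

Section laws.
Context {R : realType} {disp : measure_display} {T : measurableType disp}.
Variable P : probability T R.

(** Positive and negative parts are transported separately; both sides are then the same difference,
    also when it is infinite. *)
Lemma integral_has_law n (X : {mfun T >-> 'cV[R]_n}) (mu : probability 'cV[R]_n R)
    (f : 'cV[R]_n -> \bar R) : has_law P X mu -> measurable_fun setT f ->
  (\int[P]_w f (X w) = \int[mu]_x f x)%E.
Proof.
move=> XP mf.
have ge0 (g : 'cV[R]_n -> \bar R) : measurable_fun setT g ->
    (forall x, 0 <= g x)%E -> (\int[P]_w g (X w) = \int[mu]_x g x)%E.
  move=> mg g0; transitivity (\int[distribution P X]_x g x)%E.
    by rewrite ge0_integral_pushforward//= preimage_setT.
  by apply: eq_measure_integral => A mA _; exact: XP.
rewrite integralE [RHS]integralE; congr (_ - _)%E.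
  apply: etrans _ (ge0 (f^\+)%E (measurable_funepos mf) (funepos_ge0 f)).
  by apply: eq_integral => w _; rewrite !funeposE.
apply: etrans _ (ge0 (f^\-)%E (measurable_funeneg mf) (funeneg_ge0 f)).
by apply: eq_integral => w _; rewrite !funenegE.
Qed.

End laws.

Section affine.
Context {R : realType}.

(** In contrast to [affine_cV], the matrix may be rectangular: couplings arise as several images of
    one Gaussian vector of size [d + d]. *)
Definition affine_mx n d (m : 'cV[R]_d) (A : 'M[R]_(d, n)) (z : 'cV[R]_n) :
  'cV[R]_d := m + A *m z.

Lemma measurable_affine_mx n d (m : 'cV[R]_d) (A : 'M[R]_(d, n)) :
  measurable_fun setT (affine_mx m A).
Proof.
apply/measurable_fun_cVP => i; under eq_fun do rewrite mxE.
apply: measurable_funD => //.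
by have /measurable_fun_cVP := measurable_mulmx A; exact.
Qed.

HB.instance Definition _ n d (m : 'cV[R]_d) (A : 'M[R]_(d, n)) :=
  @isMeasurableFun.Build _ _ _ _ (affine_mx m A) (measurable_affine_mx m A).

(** The law is defined through the factor [psd_sqrt S]; [std_gaussian_gram], applied to the
    indicator of [E] shifted by [m], allows any other factor [A] of [S]. *)
Lemma gaussian_has_law n d (m : 'cV[R]_d) (A : 'M[R]_(d, n)) (S : 'M[R]_d) :
  is_covariance S -> A *m A^T = S ->
  has_law (std_gaussian n) (affine_mx m A) (gaussian m S).
Proof.
move=> covS AS E mE.
have [covs sE] := psd_sqrtP covS.
have gram : A *m A^T = psd_sqrt S *m (psd_sqrt S)^T.
  by rewrite (covariance_sym covs) sE.
pose f (x : 'cV[R]_d) : \bar R := (\1_E (m + x))%:E.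
have mf : measurable_fun setT f.
  apply/measurable_EFinP; apply: measurableT_comp; first exact: measurable_indic.
  apply/measurable_fun_cVP => i; under eq_fun do rewrite mxE.
  by apply: measurable_funD => //; exact: measurable_coord.
have f0 x : (0 <= f x)%E by rewrite lee_fin.
have := std_gaussian_gram gram mf f0.
have ind k (g : 'cV[R]_k -> 'cV[R]_d) : measurable_fun setT g ->
    (\int[std_gaussian k]_z (\1_E (g z))%:E = std_gaussian k (g @^-1` E))%E.
  move=> mg; rewrite -[in RHS](setIT (g @^-1` E)) -integral_indic//.
  by rewrite -(setTI (_ @^-1` _)); exact: mg.
rewrite /f ind; last exact: measurable_affine_mx.
by rewrite ind//; exact: measurable_affine_mx.
Qed.

End affine.

Section gaussian_moments.
Context {R : realType}.

Local Notation one := (fun=> (1%:M : 'cV[R]_1)).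

Lemma cons_cV_ord0 n (p : measurableTypeR R * 'cV[R]_n) :
  cons_cV p ord0 ord0 = p.1.
Proof.
rewrite /cons_cV (_ : ord0 = lshift n (ord0 : 'I_1)); last exact: val_inj.
by rewrite [LHS](@col_mxEu _ 1 n 1) mxE !ord1 eqxx mulr1n.
Qed.

(** The row [u^T] and the 1 by 1 matrix [|u|] have the same Gram matrix, so [u . z] is distributed
    as [|u|] times one standard normal variable. *)
Lemma std_gaussian_form n (u : 'cV[R]_n) :
  (\int[std_gaussian n]_z (((u^T *m z) 0 0) ^+ 2)%:E = ((u^T *m u) 0 0)%:E)%E.
Proof.
pose c := Num.sqrt ((u^T *m u) 0 0).
have gram : u^T *m (u^T)^T = c%:M *m (c%:M : 'M[R]_1)^T.
  rewrite trmxK tr_scalar_mx -scalar_mxM -expr2 sqr_sqrtr ?dot_ge0//.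
  by apply/matrixP => i j; rewrite !ord1 [RHS]mxE mulr1n.
pose f (y : 'cV[R]_1) : \bar R := (y 0 0 ^+ 2)%:E.
have mf : measurable_fun setT f.
  apply/measurable_EFinP; apply: measurable_funX; exact: measurable_coord.
have f0 x : (0 <= f x)%E by rewrite lee_fin sqr_ge0.
apply: etrans (std_gaussian_gram gram mf f0) _.
have mg : measurable_fun setT (fun z : 'cV[R]_1 => f (c%:M *m z)).
  exact: (measurableT_comp mf (measurable_mulmx _)).
apply: etrans (integral_std_gaussianS mg (fun z => f0 _)) _.
transitivity (\int[normal_prob 0 1]_x ((c ^+ 2)%:E * (x ^+ 2)%:E))%E.
  apply: eq_integral => x _.
  rewrite integral_std_gaussian0; last first.
    apply: (measurableT_comp mg); apply: (measurableT_comp (@measurable_cons_cV R 0)).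
    exact: measurable_pair1.
  by rewrite /f mul_scalar_mx mxE cons_cV_ord0 exprMn EFinM.
rewrite ge0_integralZl//=.
- by rewrite normal_prob_second_moment mule1 sqr_sqrtr ?dot_ge0.
- by apply/measurable_EFinP; exact: measurable_funX.
- by move=> x _; rewrite lee_fin sqr_ge0.
- by rewrite lee_fin sqr_ge0.
Qed.

(** Polarization, on sums of two basis vectors. *)
Lemma form_inj n (M N : 'M[R]_n) : M^T = M -> N^T = N ->
  (forall u : 'cV_n, (u^T *m M *m u) 0 0 = (u^T *m N *m u) 0 0) -> M = N.
Proof.
move=> symM symN MN.
have pol (A : 'M[R]_n) (u v : 'cV[R]_n) : A^T = A ->
    ((u + v)^T *m A *m (u + v)) 0 0 = (u^T *m A *m u) 0 0 + (v^T *m A *m v) 0 0 +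
      2 * (u^T *m A *m v) 0 0.
  move=> symA; rewrite [(u + v)^T]raddfD /= !mulmxDl !mulmxDr.
  have -> : v^T *m A *m u = (u^T *m A *m v)^T by rewrite !trmx_mul trmxK symA mulmxA.
  set a := u^T *m A *m u; set b := v^T *m A *m v; set c := u^T *m A *m v.
  by rewrite !mxE; ring.
apply/matrixP => i j.
pose u : 'cV[R]_n := delta_mx i 0; pose v : 'cV[R]_n := delta_mx j 0.
have E (A : 'M[R]_n) : A i j = (u^T *m A *m v) 0 0.
  by rewrite trmx_delta -rowE -colE !mxE.
have := MN (u + v); rewrite !pol// !MN -!E => /addrI.
by apply: mulfI; rewrite pnatr_eq0.
Qed.

Lemma std_gaussian_square_integrable n :
  square_integrable_vec (std_gaussian n) (fun z : 'cV[R]_n => z).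
Proof.
move=> i; split; first exact: measurable_coord.
apply/integrableP; split.
  by apply/measurable_EFinP; apply: measurable_funX; exact: measurable_coord.
have := std_gaussian_form (delta_mx i 0 : 'cV[R]_n).
rewrite (_ : (\int[_]_z _ = \int[std_gaussian n]_x `|(x i ord0 ^+ 2)%:E|)%E).
  by move=> ->; rewrite ltry.
apply: eq_integral => z _; rewrite abse_EFin ger0_norm ?sqr_ge0//.
by rewrite trmx_delta -rowE mxE.
Qed.

Lemma std_gaussian_moment n :
  moment (std_gaussian n) (fun z : 'cV[R]_n => z) (fun z => z) = 1%:M.
Proof.
apply: form_inj; [exact: moment_tr|exact: trmx1|move=> u].
rewrite moment_gram; last exact: std_gaussian_square_integrable.
by rewrite /Rintegral std_gaussian_form mulmx1.
Qed.

(** Both [-1] and [1] are factors of the identity covariance, so [- z] has the law of [z] and the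
    mean equals its opposite. *)
Lemma std_gaussian_mean n :
  moment (std_gaussian n) (fun z : 'cV[R]_n => z) one = 0.
Proof.
apply/matrixP => i j; rewrite !mxE.
transitivity (\int[std_gaussian n]_z (z i ord0 : R)).
  by apply: eq_Rintegral => z _; rewrite (ord1 j) eqxx mulr1.
have sz := std_gaussian_square_integrable (n := n) i.
have iz := square_integrable_integrable sz.
pose U : 'M[R]_n := (-1)%:M.
have covI : is_covariance (1%:M : 'M[R]_n).
  by have := covariance_gram (1%:M : 'M[R]_n); rewrite trmx1 mulmx1.
have mi : measurable_fun setT (fun z : 'cV[R]_n => (z i ord0)%:E).
  by apply/measurable_EFinP; exact: measurable_coord.
have U1 : U *m U^T = 1%:M.
  by rewrite tr_scalar_mx -scalar_mxM mulrNN mulr1.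
have h1 := integral_has_law (gaussian_has_law 0 covI U1) mi.
have h2 := integral_has_law (gaussian_has_law 0 covI (_ : 1%:M *m 1%:M^T = 1%:M)) mi.
have {h2}h2 := h2 (etrans (congr1 (mulmx _) (trmx1 _ _)) (mulmx1 _)).
have h3 : \int[std_gaussian n]_z (- z i ord0) = \int[std_gaussian n]_z (z i ord0 : R).
  rewrite /Rintegral; congr fine; apply: etrans (etrans _ (etrans h1 (esym h2))) _.
    apply: eq_integral => z _.
    by rewrite /= /affine_mx add0r mul_scalar_mx scaleN1r mxE.
  by apply: eq_integral => z _; rewrite /= /affine_mx add0r mul1mx.
clear h1 h2; move: h3; under eq_Rintegral do rewrite -mulN1r.
by rewrite RintegralZl// => h; lra.
Qed.

(** Moments depend on the law alone: those of a Gaussian law are computed once, on its standard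
    representation, and carried to every coupling. *)
Lemma moment_has_law d disp (T : measurableType disp) (P : probability T R)
    disp' (T' : measurableType disp') (P' : probability T' R)
    (X : {mfun T >-> 'cV[R]_d}) (X' : {mfun T' >-> 'cV[R]_d}) mu (m : 'cV[R]_d) :
  has_law P X mu -> has_law P' X' mu ->
  square_integrable_vec P' (fun w => X' w - m) ->
  [/\ square_integrable_vec P (fun w => X w - m),
      moment P (fun w => X w - m) (fun w => X w - m) =
        moment P' (fun w => X' w - m) (fun w => X' w - m) &
      moment P (fun w => X w - m) one = moment P' (fun w => X' w - m) one].
Proof.
move=> PX PX' sX'.
have mcoord i : measurable_fun setT (fun x : 'cV[R]_d => (x - m) i ord0).
  under eq_fun do rewrite mxE; apply: measurable_funD => //.
  exact: measurable_coord.
have tr f : measurable_fun setT f ->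
    (\int[P]_w (f (X w))%:E = \int[P']_w (f (X' w))%:E)%E.
  move=> /measurable_EFinP mf.
  by rewrite (integral_has_law PX mf) (integral_has_law PX' mf).
split.
- move=> i; split.
    exact: (measurableT_comp (mcoord i) (measurable_funPT X)).
  have [_ /integrableP[_ h]] := sX' i; apply/integrableP; split.
    apply/measurable_EFinP; apply: measurable_funX.
    exact: (measurableT_comp (mcoord i) (measurable_funPT X)).
  rewrite (tr (fun x => `|(x - m) i ord0 ^+ 2|))//.
  apply: measurableT_comp => //; apply: measurable_funX; exact: mcoord.
- apply/matrixP => i j; rewrite !mxE /Rintegral; congr fine.
  apply: (tr (fun x => (x - m) i ord0 * (x - m) j ord0)).
  by apply: measurable_funM; exact: mcoord.
- apply/matrixP => i j; rewrite !mxE /Rintegral; congr fine.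
  apply: (tr (fun x => (x - m) i ord0 * _)).
  by apply: measurable_funM => //; exact: mcoord.
Qed.

Lemma gaussian_moments d disp (T : measurableType disp) (P : probability T R)
    (X : {mfun T >-> 'cV[R]_d}) (m : 'cV[R]_d) (S : 'M[R]_d) :
  is_covariance S -> has_law P X (gaussian m S) ->
  [/\ square_integrable_vec P (fun w => X w - m),
      moment P (fun w => X w - m) (fun w => X w - m) = S &
      moment P (fun w => X w - m) one = 0].
Proof.
move=> covS PX; have [covs sE] := psd_sqrtP covS.
have PA : has_law (std_gaussian d) (affine_mx m (psd_sqrt S)) (gaussian m S).
  by apply: gaussian_has_law => //; rewrite (covariance_sym covs).
have sz := @std_gaussian_square_integrable d.
have AE : (fun z : 'cV[R]_d => affine_mx m (psd_sqrt S) z - m) =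
    (fun z => psd_sqrt S *m z).
  by apply/funext => z; rewrite /affine_mx addrC addKr.
have sA : square_integrable_vec (std_gaussian d)
    (fun z => affine_mx m (psd_sqrt S) z - m).
  by rewrite AE; exact: square_integrable_vec_mul.
have [sX -> ->] := moment_has_law PX PA sA; split => //.
  rewrite AE moment_mull ?moment_mulr//; last exact: square_integrable_vec_mul.
  by rewrite std_gaussian_moment mul1mx (covariance_sym covs).
rewrite AE moment_mull// ?std_gaussian_mean ?mulmx0//.
exact: square_integrable_vec_cst.
Qed.

End gaussian_moments.

(** * Gaussian laws in the convex order *)

Section convex_functions.
Context {R : realType} {d : nat}.
Implicit Types h : 'cV[R]_d -> R.
Local Notation convex h := (convex_function (E := 'cV[R]_d) setT h).

Lemma convex_functionP h : convex h <->
  forall t x y, 0 <= t <= 1 -> h (t *: x + (1 - t) *: y) <= t * h x + (1 - t) * h y.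
Proof.
split=> [cvx t x y /andP[t0 t1]|cvx t x y _ _].
  by have := cvx (Itv01 t0 t1) x y; rewrite !inE; exact.
by apply: (cvx t%:num); rewrite ge0 le1.
Qed.

(** Induction on the number [k] of leading coordinates that may be nonzero. The centre [c] varies,
    because removing a coordinate shifts it by a basis vector in either direction. *)
Lemma convex_bounded_cube h (c : 'cV[R]_d) : convex h ->
  exists M, forall z : 'cV[R]_d, (forall i, `|z i ord0| <= 1) -> h (c + z) <= M.
Proof.
move=> /convex_functionP cvx.
suff : forall k, exists M, forall z : 'cV[R]_d, (forall i, `|z i ord0| <= 1) ->
    (forall i : 'I_d, (k <= i)%N -> z i ord0 = 0) -> h (c + z) <= M.
  move=> /(_ d)[M hM]; exists M => z z1; apply: hM => // i.
  by rewrite leqNgt ltn_ord.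
move=> k; elim: k c => [|k IH] c.
  exists (h c) => z _ z0; have -> : z = 0 by apply/colP => i; rewrite z0// mxE.
  by rewrite addr0.
have [kd|dk] := ltnP k d; last first.
  have [M hM] := IH c; exists M => z z1 z0; apply: hM => // i ki; apply: z0.
  by have := leq_trans dk ki; rewrite leqNgt ltn_ord.
pose e : 'cV[R]_d := delta_mx (Ordinal kd) ord0.
have [M1 hM1] := IH (c + e); have [M2 hM2] := IH (c - e).
exists (Num.max M1 M2) => z z1 z0.
pose a := z (Ordinal kd) ord0; pose z' := z - a *: e.
have z'E i : z' i ord0 = if i == Ordinal kd then 0 else z i ord0.
  rewrite !mxE eqxx andbT; case: eqP => [->|_]; first by rewrite mulr1 subrr.
  by rewrite mulr0 subr0.
have z'1 i : `|z' i ord0| <= 1 by rewrite z'E; case: ifP; rewrite ?normr0.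
have z'0 (i : 'I_d) : (k <= i)%N -> z' i ord0 = 0.
  rewrite z'E leq_eqVlt => /predU1P[ki|ki]; last by rewrite z0// if_same.
  by have -> : i == Ordinal kd by apply/eqP/val_inj.
have /andP[a1 a2] : -1 <= a <= 1 by rewrite -ler_norml z1.
(* The weights [(1 + a) / 2] and [(1 - a) / 2] average [e] and [- e] to [a e]. *)
have -> : c + z = ((1 + a) / 2) *: (c + e + z') + (1 - (1 + a) / 2) *: (c - e + z').
  by apply/colP => i; rewrite !mxE; field.
have t01 : 0 <= (1 + a) / 2 <= 1 by apply/andP; split; lra.
apply: le_trans (cvx _ _ _ t01) _.
have := hM1 _ z'1 z'0; have := hM2 _ z'1 z'0.
have : M1 <= Num.max M1 M2 by rewrite le_max lexx.
have : M2 <= Num.max M1 M2 by rewrite le_max lexx orbT.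
move: (Num.max _ _) (h _) (h _) ((1 + a) / 2) t01 => m p q t /andP[t0 t1] *.
by nra.
Qed.

(** The origin lies between [x] and the point [- x / (1 + s)] of the unit cube, where [h] is bounded
    above, so convexity bounds [h x] from below. Linear growth makes the negative part of [h]
    integrable for Gaussian laws. *)
Lemma convex_lower_bound h : convex h ->
  exists K, 0 <= K /\ forall x : 'cV[R]_d, - (K * (2 + \sum_i `|x i ord0|)) <= h x.
Proof.
move=> cvxh; have [M hM] := convex_bounded_cube 0 cvxh.
have /convex_functionP cvx := cvxh.
exists (`|h 0| + `|M|); split; first by rewrite addr_ge0.
move=> x; set s := \sum_i _.
have s0 : 0 <= s by apply: sumr_ge0.
pose z := - (1 + s)^-1 *: x.
have s1 : 0 < 1 + s by lra.
have z1 i : `|z i ord0| <= 1.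
  rewrite mxE normrM normrN normfV (gtr0_norm s1) mulrC ler_pdivrMr// mul1r.
  have : `|x i ord0| <= s by rewrite /s (bigD1 i)//= lerDl sumr_ge0.
  by lra.
have t01 : 0 <= (2 + s)^-1 <= 1.
  by apply/andP; split; [rewrite invr_ge0|rewrite invf_le1]; lra.
have := cvx _ x z t01; have := hM _ z1; rewrite add0r => hz.
have -> : (2 + s)^-1 *: x + (1 - (2 + s)^-1) *: z = 0.
  apply/colP => i; rewrite !mxE; field.
  by apply/andP; split; rewrite gt_eqF//; lra.
have t0 : 0 < (2 + s)^-1 by rewrite invr_gt0; lra.
rewrite -(ler_pM2l (_ : 0 < 2 + s)); last by lra.
have -> : (2 + s) * ((2 + s)^-1 * h x + (1 - (2 + s)^-1) * h z) = h x + (1 + s) * h z.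
  by field; rewrite gt_eqF//; lra.
have := ler_norm (- h 0); have := ler_norm M; rewrite normrN.
move: (`|h 0|) (`|M|) (normr_ge0 (h 0)) (normr_ge0 M) => u v *.
by nra.
Qed.

(** A point near [x] is obtained by moving a small fraction [e] of the way from [x] to a point of
    the unit cube around it, where [h <= M]. *)
Lemma convex_upper_semicontinuous h t (x : 'cV[R]_d) : convex h -> h x < t ->
  exists2 e, 0 < e & forall y : 'cV[R]_d, (forall i, `|y i ord0 - x i ord0| <= e) -> h y < t.
Proof.
move=> cvxh hxt; have [M hM] := convex_bounded_cube x cvxh.
have /convex_functionP cvx := cvxh.
(* Adding 1 keeps the divisor [2 * D] positive, also when [M = h x]. *)
pose D := `|M - h x| + 1.
have D0 : 0 < D by rewrite ltr_wpDl.
pose e := Num.min 1 ((t - h x) / (2 * D)).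
have e0 : 0 < e by rewrite lt_min ltr01 divr_gt0// ?subr_gt0// mulr_gt0.
exists e => // y yx; pose z := e^-1 *: (y - x).
have z1 i : `|z i ord0| <= 1.
  by rewrite !mxE normrM normfV (gtr0_norm e0) mulrC ler_pdivrMr// mul1r.
have -> : y = e *: (x + z) + (1 - e) *: x.
  by apply/colP => i; rewrite !mxE; field; rewrite gt_eqF.
have e01 : 0 <= e <= 1 by rewrite ltW// ge_min lexx.
apply: le_lt_trans (cvx _ _ _ e01) _.
have eD : e * (2 * D) <= t - h x.
  by rewrite -ler_pdivlMr ?mulr_gt0// ge_min lexx orbT.
have := hM _ z1; have : M - h x <= D - 1 by rewrite /D addrK ler_norm.
move: (h (x + z)) => q *; nra.
Qed.

(** The sigma-algebra comes from the coordinates, so openness has to be made countable: a strict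
    sublevel set is a union of cubes with rational centres and radii [1 / (k + 1)]. *)
Lemma measurable_convex h : convex h -> measurable_fun setT h.
Proof.
move=> cvxh.
pose box (q : 'cV[rat]_d * nat) : set 'cV[R]_d :=
  [set x | forall i, `|x i ord0 - ratr (q.1 i ord0)| < q.2.+1%:R^-1].
have mbox q : measurable (box q).
  rewrite (_ : box q = \bigcap_(i in [set: 'I_d])
      [set x | `|x i ord0 - ratr (q.1 i ord0)| < q.2.+1%:R^-1]).
    apply: fin_bigcap_measurable => // i _.
    have mf : measurable_fun setT (fun x : 'cV[R]_d => `|x i ord0 - ratr (q.1 i ord0)|).
      apply: measurableT_comp => //; apply: measurable_funB => //.
      exact: measurable_coord.
    have := mf measurableT _ (measurable_itv `]-oo, q.2.+1%:R^-1[); rewrite setTI.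
    by congr measurable; apply/seteqP; split => x /=; rewrite in_itv.
  by apply/seteqP; split => x /= h1 i; [move=> _|]; exact: h1.
have mlt t : measurable [set x | h x < t].
  pose Q := [set q | box q `<=` [set x | h x < t]].
  rewrite (_ : [set x | h x < t] = \bigcup_(q in Q) box q); last first.
    apply/seteqP; split => [x /= hxt|x [q Qq xq]]; last exact: Qq.
    have [e e0 he] := convex_upper_semicontinuous cvxh hxt.
    (* Half of [e], since [x] and [y] are both compared with the centre [q]. *)
    have [k hk] : exists k : nat, k.+1%:R^-1 < e / 2.
      have e20 : 0 < e / 2 by rewrite divr_gt0.
      by have [k _ /(_ k (leqnn k)) hk] := near_infty_natSinv_lt (PosNum e20); exists k.
    have k0 : 0 < k.+1%:R^-1 :> R by rewrite invr_gt0.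
    have qex (i : 'I_d) : {q : rat | `|x i ord0 - ratr q| < k.+1%:R^-1}.
      apply: cid; have /rat_in_itvoo[q] : x i ord0 - k.+1%:R^-1 < x i ord0 + k.+1%:R^-1.
        by move: (k.+1%:R^-1) k0 => a *; lra.
      rewrite in_itv/= => /andP[q1 q2]; exists q.
      rewrite ltr_norml; move: (k.+1%:R^-1) q1 q2 => a *.
      by apply/andP; split; lra.
    pose q : 'cV[rat]_d := \col_i sval (qex i).
    have xq i : `|x i ord0 - ratr (q i ord0)| < k.+1%:R^-1.
      by rewrite mxE; exact: (svalP (qex i)).
    exists (q, k) => //= y yq; apply: he => i.
    rewrite (_ : y i ord0 - x i ord0 = (y i ord0 - ratr (q i ord0)) -
      (x i ord0 - ratr (q i ord0))); last by ring.
    apply: le_trans (ler_normB _ _) _.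
    have := xq i; have := yq i => /=; move: (k.+1%:R^-1) hk => a *; lra.
  rewrite bigcup_mkcond; apply: countable_bigcupT_measurable => // q.
  by case: ifP.
apply: (measurability _ (RGenInftyO.measurableE R)) => _ [_ [t ->] <-].
rewrite setTI; have -> : h @^-1` `]-oo, t[ = [set x | h x < t].
  by apply/seteqP; split => x /=; rewrite in_itv.
exact: mlt.
Qed.

End convex_functions.

Section convex_order.
Context {R : realType} {d : nat}.
Local Notation convex h := (convex_function (E := 'cV[R]_d) setT h).
Local Notation one := (fun=> (1%:M : 'cV[R]_1)).

Lemma convex_sqr_form (u m : 'cV[R]_d) :
  convex (fun x => ((u^T *m (x - m)) 0 0) ^+ 2).
Proof.
apply/convex_functionP => t x y /andP[t0 t1].
have -> : t *: x + (1 - t) *: y - m = t *: (x - m) + (1 - t) *: (y - m).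
  by apply/colP => i; rewrite !mxE; ring.
rewrite mulmxDr -!scalemxAr.
move: (u^T *m (x - m)) (u^T *m (y - m)) => a b.
rewrite ![in leLHS]mxE; move: (a 0 0) (b 0 0) => p q.
have t01 : 0 <= t * (1 - t) by rewrite mulr_ge0// subr_ge0.
rewrite -subr_ge0.
have -> : t * p ^+ 2 + (1 - t) * q ^+ 2 - (t * p + (1 - t) * q) ^+ 2 =
  t * (1 - t) * (p - q) ^+ 2 by ring.
by rewrite mulr_ge0// sqr_ge0.
Qed.

Lemma convex_coord (c : R) (m : 'cV[R]_d) i :
  convex (fun x => c * (x - m) i ord0).
Proof.
by apply/convex_functionP => t x y _; rewrite !mxE le_eqVlt; apply/orP; left;
  apply/eqP; ring.
Qed.

Lemma square_integrable_form disp (T : measurableType disp) (P : probability T R)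
    (X : T -> 'cV[R]_d) (u : 'cV[R]_d) : square_integrable_vec P X ->
  (\int[P]_w (((u^T *m X w) 0 0) ^+ 2)%:E =
   ((u^T *m moment P X X *m u) 0 0)%:E)%E.
Proof.
move=> sX; rewrite moment_gram// /Rintegral fineK//.
by apply: integrable_fin_num => //; have [] := square_integrable_vec_mul u^T sX ord0.
Qed.

Lemma moment_one disp (T : measurableType disp) (P : probability T R)
    (X : T -> 'cV[R]_d) i j : moment P X one i j = \int[P]_w (X w i ord0).
Proof.
by rewrite mxE; apply: eq_Rintegral => w _; rewrite (ord1 j) mxE eqxx mulr1.
Qed.

(** Two families of convex test functions suffice: the squares of [u . (x - m)] bound the
    covariance, and the coordinates, taken with both signs, fix the mean. *)
Lemma convex_le_moments disp (T : measurableType disp) (P : probability T R)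
    (X : {mfun T >-> 'cV[R]_d}) eta (m : 'cV[R]_d) (S : 'M[R]_d) :
  is_covariance S -> has_law P X eta -> convex_le eta (gaussian m S) ->
  [/\ square_integrable_vec P (fun w => X w - m),
      moment P (fun w => X w - m) one = 0 &
      forall u : 'cV_d,
        (u^T *m moment P (fun w => X w - m) (fun w => X w - m) *m u) 0 0 <=
        (u^T *m S *m u) 0 0].
Proof.
move=> covS PX cvx; have [covs sE] := psd_sqrtP covS.
have PA : has_law (std_gaussian d) (affine_mx m (psd_sqrt S)) (gaussian m S).
  by apply: gaussian_has_law => //; rewrite (covariance_sym covs).
have [sA momA meanA] := gaussian_moments covS PA.
have le h : convex h -> (\int[P]_w (h (X w))%:E <=
    \int[std_gaussian d]_z (h (affine_mx m (psd_sqrt S) z))%:E)%E.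
  move=> cvxh; have /measurable_EFinP mh := measurable_convex cvxh.
  by rewrite (integral_has_law PX mh) (integral_has_law PA mh); exact: cvx.
have leform (u : 'cV[R]_d) :
    (\int[P]_w (((u^T *m (X w - m)) 0 0) ^+ 2)%:E <= ((u^T *m S *m u) 0 0)%:E)%E.
  rewrite -momA -square_integrable_form//.
  exact: (le _ (convex_sqr_form u m)).
have mX i : measurable_fun setT (fun w => (X w - m) i ord0).
  under eq_fun do rewrite mxE; apply: measurable_funD => //.
  exact: (measurableT_comp (measurable_coord i) (measurable_funPT X)).
(* [leform] is stated for extended integrals, so at a basis vector it already yields finiteness. *)
have sX : square_integrable_vec P (fun w => X w - m).
  move=> i; split; first exact: mX.
  apply/integrableP; split; first by apply/measurable_EFinP; exact: measurable_funX.
  apply: le_lt_trans (le_lt_trans (leform (delta_mx i 0)) (ltry _)).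
  rewrite le_eqVlt; apply/orP; left; apply/eqP; apply: eq_integral => w _.
  by rewrite abse_EFin ger0_norm ?sqr_ge0// trmx_delta -rowE [row _ _ _ _]mxE.
split=> // [|u]; last by rewrite -lee_fin -square_integrable_form.
apply/matrixP => i j; rewrite moment_one [RHS]mxE.
have iX : P.-integrable setT (EFin \o (fun w => (X w - m) i ord0)).
  exact: square_integrable_integrable.
have iA : (std_gaussian d).-integrable setT
    (EFin \o (fun w => (affine_mx m (psd_sqrt S) w - m) i ord0)).
  exact: square_integrable_integrable (sA i).
have A0 : \int[std_gaussian d]_w ((affine_mx m (psd_sqrt S) w - m) i ord0) = 0.
  by rewrite -(moment_one _ _ i ord0) meanA mxE.
have lec (c : R) : c * \int[P]_w ((X w - m) i ord0) <= 0.
  rewrite -RintegralZl// -[leRHS](mulr0 c) -[X in _ <= c * X]A0 -RintegralZl//.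
  have icX : P.-integrable setT (EFin \o (fun w => c * (X w - m) i ord0)).
    by apply: (eq_integrable measurableT (fun w => c%:E * ((X w - m) i ord0)%:E)%E) => //; exact: integrableZl.
  have icA : (std_gaussian d).-integrable setT
      (EFin \o (fun w => c * (affine_mx m (psd_sqrt S) w - m) i ord0)).
    apply: (eq_integrable measurableT (fun w => c%:E * ((affine_mx m (psd_sqrt S) w - m) i ord0)%:E)%E) => //.
    exact: integrableZl.
  rewrite /Rintegral; apply: fine_le; [exact: integrable_fin_num|exact: integrable_fin_num|].
  exact: (le _ (convex_coord c m i)).
by have := lec 1; have := lec (- 1); lra.
Qed.

(* N(m, S) is the law of the midpoint of Y+ and Y-, both of law N(m, S'). *)
Lemma convex_le_gaussian (m : 'cV[R]_d) (S S' : 'M[R]_d) :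
  is_covariance S -> is_covariance S' -> cov_le S S' ->
  convex_le (gaussian m S) (gaussian m S').
Proof.
move=> covS covS' SS' h cvxh.
have [covA AE] := psd_sqrtP covS; have [covB BE] := psd_sqrtP SS'.
set A := psd_sqrt S in covA AE; set B := psd_sqrt (S' - S) in covB BE.
pose P := @std_gaussian R (d + d).
have lawX : has_law P (affine_mx m (row_mx A 0)) (gaussian m S).
  apply: gaussian_has_law => //.
  by rewrite tr_row_mx mul_row_col mul0mx addr0 (covariance_sym covA).
have lawY : has_law P (affine_mx m (row_mx A B)) (gaussian m S').
  apply: gaussian_has_law => //.
  rewrite tr_row_mx mul_row_col (covariance_sym covA) (covariance_sym covB).
  by rewrite AE BE addrC subrK.
have lawZ : has_law P (affine_mx m (row_mx A (- B))) (gaussian m S').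
  apply: gaussian_has_law => //.
  rewrite tr_row_mx mul_row_col [(- B)^T]raddfN /= mulNmx mulmxN opprK.
  by rewrite (covariance_sym covA) (covariance_sym covB) AE BE addrC subrK.
have mh := measurable_convex cvxh.
have /measurable_EFinP mEh := mh.
rewrite -(integral_has_law lawX mEh).
have [K [K0 hK]] := convex_lower_bound cvxh.
pose L (x : 'cV[R]_d) := K * (2 + \sum_i `|x i ord0|).
have L0 x : 0 <= L x by rewrite mulr_ge0// addr_ge0// sumr_ge0.
have mL : measurable_fun setT L.
  apply: measurable_funM => //; apply: measurable_funD => //.
  apply: measurable_sum => i; apply: measurableT_comp => //; exact: measurable_coord.
have iL (C : 'M[R]_(d, d + d)) : P.-integrable setT (EFin \o (L \o affine_mx m C)).
  have sC : square_integrable_vec P (affine_mx m C).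
    apply: square_integrable_vecD; first exact: square_integrable_vec_cst.
    by apply: square_integrable_vec_mul; exact: std_gaussian_square_integrable.
  have iabs i : P.-integrable setT (fun w => `|affine_mx m C w i ord0|%:E).
    exact: (integrable_abse (square_integrable_integrable (sC i))).
  have isum : P.-integrable setT (fun w => (\sum_i `|affine_mx m C w i ord0|)%:E).
    under eq_fun do rewrite -sumEFin.
    by apply: integrable_sum => // i _; exact: iabs.
  apply: (eq_integrable measurableT (fun w => K%:E *
    (2%:E + (\sum_i `|affine_mx m C w i ord0|)%:E))%E) => //.
  apply: integrableZl => //; apply: integrableD => //.
  exact: finite_measure_integrable_cst.
set Xf := affine_mx m _; set I := (\int[gaussian m S']_x _)%E.
have IY : I = (\int[P]_w (h (affine_mx m (row_mx A B) w))%:E)%E.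
  by rewrite (integral_has_law lawY mEh).
have IZ : I = (\int[P]_w (h (affine_mx m (row_mx A (- B)) w))%:E)%E.
  by rewrite (integral_has_law lawZ mEh).
have mhC (C : 'M[R]_(d, d + d)) : measurable_fun setT (fun w => (h (affine_mx m C w))%:E).
  exact: (measurableT_comp mEh (measurable_affine_mx m C)).
(* The negative part of [h] is dominated by [L]. Hence either the integral on the right is infinite
   and the inequality is trivial, or [h] is integrable along [Y+] and [Y-] and the two integrals can
   be averaged. *)
have dich (C : 'M[R]_(d, d + d)) : I = (\int[P]_w (h (affine_mx m C w))%:E)%E ->
    I = +oo%E \/ P.-integrable setT (fun w => (h (affine_mx m C w))%:E).
  move=> IC; pose f w := (h (affine_mx m C w))%:E.
  have mf : measurable_fun setT f := mhC C.
  have fn_lty : (\int[P]_w (f^\- w) < +oo)%E.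
    have /integrableP[_] := iL C; apply: le_lt_trans.
    apply: ge0_le_integral => //.
    - exact: measurable_funeneg mf.
    - apply: measurableT_comp => //; apply/measurable_EFinP.
      exact: (measurableT_comp mL (measurable_affine_mx m C)).
    - move=> w _; rewrite funenegE /f /=.
      rewrite ge_max !lee_fin normr_ge0 andbT ger0_norm ?L0//.
      by rewrite lerNl; exact: hK.
  have [fp_lty|] := boolP (\int[P]_w (f^\+ w) < +oo)%E.
    right; apply/integrableP; split => //.
    have -> : (\int[P]_w `|f w| = \int[P]_w (f^\+ w) + \int[P]_w (f^\- w))%E.
      rewrite -ge0_integralD//.
      - by apply: eq_integral => w _; rewrite -/((abse \o f) w) fune_abse.
      - exact: measurable_funepos mf.
      - exact: measurable_funeneg mf.
    by rewrite lte_add_pinfty.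
  rewrite -leNgt leye_eq => /eqP fpy; left; rewrite IC integralE fpy.
  apply: addye.
  by rewrite -[X in _ != X]/(- +oo)%E eqe_opp lt_eqF.
have [->|iY] := dich _ IY; first by rewrite leey.
have [->|iZ] := dich _ IZ; first by rewrite leey.
have iG : P.-integrable setT (fun w => (2^-1)%:E *
    ((h (affine_mx m (row_mx A B) w))%:E + (h (affine_mx m (row_mx A (- B)) w))%:E))%E.
  by apply: integrableZl => //; exact: integrableD.
have hXle w : h (Xf w) <= 2^-1 * (h (affine_mx m (row_mx A B) w) +
    h (affine_mx m (row_mx A (- B)) w)).
  have /convex_functionP cvx := cvxh.
  have h01 : 0 <= (2^-1 : R) <= 1 by rewrite invr_ge0 ler0n invf_le1 ?ler1n.
  have := cvx _ (affine_mx m (row_mx A B) w) (affine_mx m (row_mx A (- B)) w) h01.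
  have -> : 1 - 2^-1 = 2^-1 :> R by lra.
  rewrite -mulrDr; congr (_ <= _); congr h.
  rewrite /Xf /affine_mx -{1 2 3}(vsubmxK w) !mul_row_col mulNmx mul0mx addr0.
  by apply/colP => i; rewrite !mxE; field.
have IG : (I = \int[P]_w ((2^-1)%:E * ((h (affine_mx m (row_mx A B) w))%:E +
    (h (affine_mx m (row_mx A (- B)) w))%:E)))%E.
  rewrite integralZl//; last exact: integrableD.
  rewrite integralD// -IY -IZ.
  have : I \is a fin_num by rewrite IY; exact: integrable_fin_num.
  by case: I {IY IZ dich} => // r _; rewrite -EFinD -EFinM; congr EFin; field.
rewrite IG; apply: le_integral => //; last by move=> w _; rewrite -EFinD -EFinM lee_fin.
have iabsG := integrable_abse iG.
(* [h (Xf w)] lies between [- L (Xf w)] and the average, and both are integrable. *)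
apply: (le_integrable measurableT _ _ (integrableD measurableT iabsG (iL (row_mx A 0)))).
  exact: mhC.
move=> w _; rewrite /= lee_fin [leRHS]ger0_norm; last first.
  by rewrite addr_ge0//; exact: L0.
have := hXle w; have : - L (Xf w) <= h (Xf w) by exact: hK.
rewrite /=; set g := 2^-1 * _; have := ler_norm g; have := L0 (Xf w).
have := normr_ge0 g; rewrite /Xf.
by move=> *; rewrite ler_norml; apply/andP; split; lra.
Qed.

End convex_order.

(** * Transport from a Gaussian law *)

Section transport_bound.
Context {R : realType} {d : nat}.
Local Notation one := (fun=> @scalar_mx R 1 1).
Variables (m_mu m_nu : 'cV[R]_d) (S_nu a B C : 'M[R]_d).
Hypotheses (syma : a^T = a) (Ca : C *m a = B).
Hypothesis optimal : forall T L : 'M[R]_d,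
  (forall u v : 'cV[R]_d, 0 <= (u^T *m T *m u) 0 0 +
     2 * (u^T *m L *m v) 0 0 + (v^T *m (a *m a) *m v) 0 0) ->
  (forall u : 'cV[R]_d, (u^T *m T *m u) 0 0 <= (u^T *m S_nu *m u) 0 0) ->
  0 <= \tr ((C - 1%:M)^T *m (L - C *m (a *m a))).

Let V := enorm (m_nu - m_mu) ^+ 2 + \tr ((B - a)^T *m (B - a)).

Definition monge (x : 'cV[R]_d) := m_nu + C *m (x - m_mu).

Context {disp : measure_display} {T : measurableType disp}.
Variables (P : probability T R) (X Y : T -> 'cV[R]_d).
Hypotheses (sX : square_integrable_vec P (fun w => X w - m_mu))
  (sY : square_integrable_vec P (fun w => Y w - m_nu))
  (momX : moment P (fun w => X w - m_mu) (fun w => X w - m_mu) = a *m a)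
  (meanX : moment P (fun w => X w - m_mu) one = 0).

Let sone : square_integrable_vec P one.
Proof. exact: square_integrable_vec_cst. Qed.

Let W w := monge (X w) - X w.

Let WE : W = fun w => (m_nu - m_mu) *m @scalar_mx R 1 1 + (C - 1%:M) *m (X w - m_mu).
Proof.
apply/funext => w; rewrite /W /monge mulmx1 mulmxBl mul1mx.
by apply/colP => i; rewrite !mxE; ring.
Qed.

Let s1 : square_integrable_vec P (fun w => (m_nu - m_mu) *m one w).
Proof. exact: square_integrable_vec_mul. Qed.

Let s2 : square_integrable_vec P (fun w => (C - 1%:M) *m (X w - m_mu)).
Proof. exact: square_integrable_vec_mul. Qed.

Lemma monge_square_integrable : square_integrable_vec P W.
Proof. by rewrite WE; exact: square_integrable_vecD. Qed.

(** [W] is the constant [m_nu - m_mu] plus a centred vector, so the two squares add up; since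
    [C a = B], the centred part has covariance [(B - a) (B - a)^T]. *)
Lemma monge_cost : \tr (moment P W W) = V.
Proof.
rewrite WE momentDl//; last exact: square_integrable_vecD.
rewrite !momentDr// !moment_mull// !moment_mulr//.
rewrite momX -[moment P one (fun w => X w - _)]moment_tr.
rewrite [moment P (fun w => X w - _) one]meanX trmx0.
rewrite !mul0mx !mulmx0 addr0 add0r moment_cst mxtraceD; congr (_ + _).
  rewrite trmx1 mulmx1 mul1mx mxtrace_mulC enorm_sqr -dotE.
  by rewrite /mxtrace big_ord1.
have -> : (C - 1%:M) *m (a *m a *m (C - 1%:M)^T) = (B - a) *m (B - a)^T.
  have -> : B - a = (C - 1%:M) *m a by rewrite mulmxBl Ca mul1mx.
  by rewrite trmx_mul syma !mulmxA.
by rewrite mxtrace_mulC.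
Qed.

Hypotheses (meanY : moment P (fun w => Y w - m_nu) one = 0)
  (momY : forall u : 'cV[R]_d,
     (u^T *m moment P (fun w => Y w - m_nu) (fun w => Y w - m_nu) *m u) 0 0 <=
     (u^T *m S_nu *m u) 0 0).

Let D w := Y w - monge (X w).

Let DE : D = fun w => (Y w - m_nu) - C *m (X w - m_mu).
Proof. by apply/funext => w; rewrite /D /monge opprD addrA. Qed.

Let sC : square_integrable_vec P (fun w => C *m (X w - m_mu)).
Proof. exact: square_integrable_vec_mul. Qed.

Lemma monge_gap_square_integrable : square_integrable_vec P D.
Proof. by rewrite DE; exact: square_integrable_vecB. Qed.

Let sD := monge_gap_square_integrable.

(** [D] is centred, so the constant part of [W] drops out. What remains is [optimal], with [T] the
    covariance of [Y] and [L] its cross-covariance with [X]. *)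
Lemma monge_optimal : 0 <= \tr (moment P D W).
Proof.
rewrite WE momentDr// !moment_mulr//.
have -> : moment P D one = 0.
  by rewrite DE momentBl// moment_mull// [moment P (fun w => Y w - _) _]meanY
    [moment P (fun w => X w - _) _]meanX mulmx0 subr0.
rewrite mul0mx add0r mxtrace_mulC DE momentBl// moment_mull// momX.
apply: optimal momY => u v.
by have := moment_form u v sY sX; rewrite momX.
Qed.

(** Expand the square of [X - Y = - (W + D)]; [monge_optimal] gives the sign of the double
    product. *)
Lemma monge_bound : V + \tr (moment P D D) <=
  \tr (moment P (fun w => X w - Y w) (fun w => X w - Y w)).
Proof.
have sW := monge_square_integrable.
have XY w : X w - Y w = (-1)%:M *m (W w + D w).
  rewrite mul_scalar_mx scaleN1r /W /D; move: (monge (X w)) => z.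
  by apply/colP => i; rewrite !mxE; ring.
under eq_fun do rewrite XY.
have sWD := square_integrable_vecD sW sD.
rewrite moment_mull ?moment_mulr//; last exact: square_integrable_vec_mul.
rewrite tr_scalar_mx mul_scalar_mx mul_mx_scalar scalerA mulrNN mulr1 scale1r.
rewrite (momentDl sW sD sWD) (momentDr sW sW sD) (momentDr sD sW sD).
rewrite -(moment_tr P D W) !mxtraceD mxtrace_tr monge_cost.
have := monge_optimal; lra.
Qed.

End transport_bound.

(** * Equality of laws from arbitrarily close couplings *)

Section orthants.
Context {R : realType} {d : nat}.

Definition orthant (t : 'cV[R]_d) : set 'cV[R]_d :=
  [set x | forall i, x i ord0 <= t i ord0].

Lemma measurable_orthant t : measurable (orthant t).
Proof.
rewrite (_ : orthant t = \bigcap_(i in [set: 'I_d])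
    ((fun x : 'cV[R]_d => x i ord0) @^-1` `]-oo, t i ord0])).
  apply: fin_bigcap_measurable => // i _.
  by rewrite -[X in measurable X]setTI; apply: measurable_coord.
apply/seteqP; split => x /= h i; first by move=> _; rewrite /= in_itv /=; exact: h.
by have := h i I; rewrite /= in_itv.
Qed.

Lemma measurable_cV_orthant (E : set 'cV[R]_d) :
  measurable E -> <<s range orthant >> E.
Proof.
move=> mE; pose T := g_sigma_algebraType (range orthant).
have mid : measurable_fun [set: T] (id : T -> 'cV[R]_d).
  apply/measurable_fun_cVP => i.
  apply: (measurability _ (RGenInftyO.measurableE R)) => _ [_ [s ->] <-].
  rewrite setTI.
  (* The half-space [x i < s] is a countable union of orthants: [s - 1 / (n + 1)] approaches the
     strict bound, and the bound [n] on the other coordinates is eventually inactive. *)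
  pose t n : 'cV[R]_d := \col_j (if j == i then s - n.+1%:R^-1 else n%:R).
  have -> : (fun x : T => (id x : 'cV[R]_d) i ord0) @^-1` `]-oo, s[ = \bigcup_n orthant (t n).
    apply/seteqP; split => [x /=|x [n _ /(_ i)]]; last first.
      rewrite mxE eqxx /= in_itv/= => h; apply: le_lt_trans h _.
      by rewrite ltrBlDr ltrDl invr_gt0.
    rewrite in_itv/= -subr_gt0 => xs.
    have [k _ hk] := near_infty_natSinv_lt (PosNum xs).
    pose b := Num.truncn (\sum_j `|(x : 'cV[R]_d) j ord0|).
    exists (maxn k b.+1) => // j; rewrite mxE; case: eqP => [->|_].
      have := hk _ (leq_maxl k b.+1) => /=.
      by move: (_.+1%:R^-1) => a; lra.
    apply: le_trans (ler_norm _) _.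
    apply: (@le_trans _ _ (\sum_j `|(x : 'cV[R]_d) j ord0|)).
      by rewrite (bigD1 j)//= lerDl sumr_ge0.
    apply: le_trans (ltW (truncnS_gt _)) _.
    by rewrite ler_nat leq_maxr.
  apply: bigcupT_measurable => n; apply: sub_sigma_algebra.
  by exists (t n).
by have := mid measurableT _ mE; rewrite setTI.
Qed.

Lemma same_law_orthant (mu nu : probability 'cV[R]_d R) :
  (forall t, mu (orthant t) = nu (orthant t)) -> same_law mu nu.
Proof.
move=> munu E mE.
apply: (g_sigma_algebra_measure_unique (range orthant) _
  (fun n => orthant (const_mx n%:R))) => //; last exact: measurable_cV_orthant.
- by move=> _ [t _ <-]; exact: measurable_orthant.
- apply/seteqP; split => // x _.
  exists (Num.truncn (\sum_j `|x j ord0|)).+1 => // i; rewrite mxE.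
  apply: le_trans (ler_norm _) _.
  apply: (@le_trans _ _ (\sum_j `|x j ord0|)); last exact: ltW (truncnS_gt _).
  by rewrite (bigD1 i)//= lerDl sumr_ge0.
- move=> _ _ [s _ <-] [t _ <-]; exists (\col_i Num.min (s i ord0) (t i ord0)) => //.
  apply/seteqP; split => x /= h.
    by split => i; have := h i; rewrite mxE le_min => /andP[].
  by move=> i; rewrite mxE le_min (h.1 i) (h.2 i).
- by move=> _ [t _ <-]; exact: munu.
- by move=> n; apply: le_lt_trans (probability_le1 _ _) _; [exact: measurable_orthant|rewrite ltry].
Qed.

(** When [X] is in an orthant, [Y] is in the orthant enlarged by [del], outside an event that
    Markov's inequality controls. Closed orthants are decreasing limits of their enlargements, so
    the comparison passes to the limit; symmetry gives the other inequality. *)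
Lemma same_law_close (mu nu : probability 'cV[R]_d R) :
  (forall e : R, 0 < e -> exists disp (T : measurableType disp)
     (P : probability T R) (X Y : {mfun T >-> 'cV[R]_d}),
    [/\ has_law P X mu, has_law P Y nu &
        (\int[P]_w (enorm (X w - Y w) ^+ 2)%:E <= e%:E)%E]) ->
  same_law mu nu.
Proof.
move=> close.
have half (mu' nu' : probability 'cV[R]_d R) t :
    (forall e : R, 0 < e -> exists disp (T : measurableType disp)
       (P : probability T R) (X Y : {mfun T >-> 'cV[R]_d}),
      [/\ has_law P X mu', has_law P Y nu' &
          (\int[P]_w (enorm (X w - Y w) ^+ 2)%:E <= e%:E)%E]) ->
    (mu' (orthant t) <= nu' (orthant t))%E.
  move=> close'.
  pose F n := orthant (t + const_mx n.+1%:R^-1).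
  have FS n : (mu' (orthant t) <= nu' (F n))%E.
    apply/lee_addgt0Pr => e e0.
    pose del : R := n.+1%:R^-1.
    have del0 : 0 < del by rewrite invr_gt0.
    (* A cost of [e * del ^+ 2] makes Markov's bound for distances at least [del] equal to [e]. *)
    have ed0 : 0 < e * del ^+ 2 by rewrite mulr_gt0// exprn_gt0.
    have [disp [T [P [X [Y [PX PY XY]]]]]] := close' _ ed0.
    rewrite -(PX _ (measurable_orthant t)) -(PY _ (measurable_orthant _)).
    pose g w : \bar R := (enorm (X w - Y w) ^+ 2)%:E.
    have mg : measurable_fun setT g.
      apply/measurable_EFinP; rewrite /g; under eq_fun do rewrite enorm_sqr.
      apply: measurable_sum => i; apply: measurable_funX.
      under eq_fun do rewrite !mxE; apply: measurable_funB.
        exact: (measurableT_comp (measurable_coord i) (measurable_funPT X)).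
      exact: (measurableT_comp (measurable_coord i) (measurable_funPT Y)).
    pose A := [set w | (del ^+ 2)%:E <= `|g w|]%E.
    have mA : measurable A.
      rewrite -[A]setTI; apply: emeasurable_fun_c_infty => //.
      exact: measurableT_comp.
    have PA : (P A <= e%:E)%E.
      have := @le_integral_comp_abse _ _ _ P setT measurableT g (del ^+ 2) id
        (@measurable_id _ _ _) (fun _ h => h) (fun _ _ _ _ h => h) mg.
      rewrite exprn_gt0// setTI => /(_ isT) h.
      rewrite -(@lee_pmul2l _ (del ^+ 2)%:E) ?lte_fin ?exprn_gt0//.
      apply: le_trans h _; rewrite -EFinM mulrC; apply: le_trans XY.
      rewrite le_eqVlt; apply/orP; left; apply/eqP; apply: eq_integral => w _.
      by rewrite /g /= ger0_norm// sqr_ge0.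
    have mX : measurable (X @^-1` orthant t).
      by rewrite -[X in measurable X]setTI; apply: measurable_funPT => //; exact: measurable_orthant.
    have mY : measurable (Y @^-1` F n).
      by rewrite -[X in measurable X]setTI; apply: measurable_funPT => //; exact: measurable_orthant.
    have mYA : measurable (Y @^-1` F n `|` A) by exact: measurableU.
    rewrite /distribution /pushforward.
    apply: (@le_trans _ _ (P (Y @^-1` F n `|` A))).
      apply: (le_measure P (mem_set mX) (mem_set mYA)).
      move=> w /= Xt.
      have [Yt|] := pselect (F n (Y w)); first by left.
      move=> /existsNP[i /negP]; rewrite -ltNge !mxE => Yi; right.
      rewrite /A /= /g /= lee_fin ger0_norm ?sqr_ge0// enorm_sqr (bigD1 i)//=.
      apply: (@le_trans _ _ ((X w - Y w) i ord0 ^+ 2)); last first.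
        by rewrite lerDl sumr_ge0// => j _; rewrite sqr_ge0.
      rewrite !mxE -[leRHS]sqrrN opprB ler_pXn2r// ?nnegrE.
      + by have := Xt i; rewrite -/del in Yi; lra.
      + exact: ltW.
      + by have := Xt i; rewrite -/del in Yi; lra.
    apply: (le_trans (measureU2 _ mY mA)).
    by rewrite leeD2l.
  have mF n : measurable (F n) by exact: measurable_orthant.
  have capF : \bigcap_n F n = orthant t.
    apply/seteqP; split => x /= h i.
      apply/ler_addgt0Pr => e e0.
      have [k _ hk] := near_infty_natSinv_lt (PosNum e0).
      have := h k I i; rewrite !mxE; have := hk k (leqnn k) => /=.
      by move: (_.+1%:R^-1) => a; lra.
    move=> _ j; rewrite !mxE (le_trans (h j))// lerDl invr_ge0.
    by [].
  have Fnoninc : {homo F : n m / (n <= m)%N >-> (m <= n)%O}.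
    move=> n m nm; apply/subsetPset => x /= h i.
    apply: le_trans (h i) _; rewrite !mxE lerD2l lef_pV2 ?posrE//.
    by rewrite ler_nat ltnS.
  have F0 : (nu' (F 0%N) < +oo)%E.
    by apply: le_lt_trans (probability_le1 _ (mF _)) _; rewrite ltry.
  have := nonincreasing_cvg_mu F0 mF; rewrite capF.
  move=> /(_ (measurable_orthant t) Fnoninc) cF.
  by apply: cvge_ge cF; apply: nearW => n; exact: FS.
apply: same_law_orthant => t; apply/eqP; rewrite eq_le; apply/andP; split.
  exact: half.
apply: half => e /close[disp [T [P [X [Y [PX PY XY]]]]]].
exists disp, T, P, Y, X; split => //; apply: le_trans XY.
rewrite le_eqVlt; apply/orP; left; apply/eqP; apply: eq_integral => w _.
rewrite !enorm_sqr; congr EFin; apply: eq_bigr => i _.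
by rewrite !mxE -sqrrN opprB.
Qed.

End orthants.

(** * Conditional expectation against functions of [X] *)

Section pull_out.
Import HBNNSimple.
Context {R : realType} {disp disp' : measure_display} {T : measurableType disp}
  {T' : measurableType disp'}.
Variables (P : probability T R) (X : {mfun T >-> T'}).
Implicit Types U V Z : T -> R.

Let indicator_integral U A : P.-integrable setT (EFin \o U) -> measurable A ->
  P.-integrable setT (fun w => (U w * \1_A (X w))%:E) /\
  (\int[P]_w (U w * \1_A (X w))%:E = \int[P]_(w in X @^-1` A) (U w)%:E)%E.
Proof.
move=> iU mA.
have mXA : measurable (X @^-1` A).
  by rewrite -[X in measurable X]setTI; exact: measurable_funPT.
have E : (fun w => (U w * \1_A (X w))%:E) = (EFin \o U) \_ (X @^-1` A).
  apply/funext => w; rewrite patchE /= indicE.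
  have -> : (X w \in A) = (w \in X @^-1` A) by apply/idP/idP; rewrite !inE.
  by case: ifP => _; rewrite ?mulr1 ?mulr0.
split; last by rewrite [RHS]integral_mkcond -E.
by rewrite E; apply/integrable_restrict => //; rewrite setTI; exact: integrableS iU.
Qed.

Let simple_integral U (f : {nnsfun T' >-> R}) : P.-integrable setT (EFin \o U) ->
  (\int[P]_w (U w * f (X w))%:E =
   \sum_(r \in range f) r%:E * \int[P]_(w in X @^-1` (f @^-1` [set r])) (U w)%:E)%E.
Proof.
move=> iU.
have mf r : measurable (f @^-1` [set r]).
  by rewrite -[X in measurable X]setTI; exact: measurable_funPT.
rewrite fsbig_finite//=.
transitivity (\int[P]_w (\sum_(r <- finmap.enum_fset (fset_set (range f)))
    (r%:E * (U w * \1_(f @^-1` [set r]) (X w))%:E)))%E.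
  apply: eq_integral => w _; rewrite fimfunE fsbig_finite//= mulr_sumr -sumEFin.
  by apply: eq_bigr => r _; rewrite -EFinM mulrCA.
have iUr r : P.-integrable setT (fun w => (U w * \1_(f @^-1` [set r]) (X w))%:E).
  by have [] := indicator_integral iU (mf r).
rewrite integral_sum//; last by move=> r; exact: integrableZl.
apply: eq_bigr => r _; rewrite integralZl//.
by have [_ ->] := indicator_integral iU (mf r).
Qed.

(** The assumption is the case of indicators, which extends to simple functions by linearity. Simple
    approximations of [g] increase to it, so [|V g(X)|] and [|Z g(X)|] dominate the passage to the
    limit. *)
Let ge0_pull_out V Z (g : T' -> R) :
  P.-integrable setT (EFin \o V) -> P.-integrable setT (EFin \o Z) ->
  (forall A, measurable A -> (\int[P]_(w in X @^-1` A) (Z w)%:E =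
                              \int[P]_(w in X @^-1` A) (V w)%:E)%E) ->
  measurable_fun setT g -> (forall x, 0 <= g x) ->
  P.-integrable setT (fun w => (V w * g (X w))%:E) ->
  P.-integrable setT (fun w => (Z w * g (X w))%:E) ->
  (\int[P]_w (Z w * g (X w))%:E = \int[P]_w (V w * g (X w))%:E)%E.
Proof.
move=> iV iZ ZV mg g0 iVg iZg.
have mEg : measurable_fun setT (EFin \o g) by exact/measurable_EFinP.
pose f := nnsfun_approx measurableT mEg.
have g0' x : [set: T'] x -> (0 <= (EFin \o g) x)%E by rewrite lee_fin.
have conv U : P.-integrable setT (EFin \o U) ->
    P.-integrable setT (fun w => (U w * g (X w))%:E) ->
    (\int[P]_w (U w * f n (X w))%:E @[n --> \oo] --> \int[P]_w (U w * g (X w))%:E)%E.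
  move=> iU iUg.
  have mU : measurable_fun setT U by have /integrableP[/measurable_EFinP] := iU.
  have mUn n : measurable_fun setT (fun w => (U w * f n (X w))%:E).
    apply/measurable_EFinP; apply: measurable_funM => //.
    by apply: measurableT_comp => //; exact: measurable_funPT.
  have mUg : measurable_fun setT (fun w => (U w * g (X w))%:E).
    by have /integrableP[] := iUg.
  have [||_ _] := dominated_convergence measurableT mUn mUg _ (integrable_abse iUg).
  - apply: aeW => w _.
    under eq_fun do rewrite EFinM.
    rewrite EFinM; apply: cvgeZl => //.
    exact: (cvg_nnsfun_approx measurableT mEg g0' (x := X w)).
  - apply: aeW => w n _; rewrite /= lee_fin !normrM ler_wpM2l//.
    rewrite ger0_norm// ger0_norm//.
    have := le_approx n g0' (I : [set: T'] (X w)).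
    by rewrite lee_fin /f nnsfun_approxE.
  by [].
have cZ := conv _ iZ iZg; have cV := conv _ iV iVg.
apply: cvg_unique cZ _ => //.
rewrite (_ : (fun n => _) = (fun n => \int[P]_w (V w * f n (X w))%:E)%E)//.
apply/funext => n; rewrite !simple_integral//; apply: eq_fsbigr => r _.
congr (_ * _)%E; apply: ZV.
by rewrite -[X in measurable X]setTI; exact: measurable_funPT.
Qed.

(** The defining property of [Z = E(V | X)], extended to possibly unbounded [g]; it is applied to
    the coordinates of [monge x - x], which are affine. *)
Lemma pull_out V Z (g : T' -> R) :
  P.-integrable setT (EFin \o V) -> P.-integrable setT (EFin \o Z) ->
  (forall A, measurable A -> (\int[P]_(w in X @^-1` A) (Z w)%:E =
                              \int[P]_(w in X @^-1` A) (V w)%:E)%E) ->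
  measurable_fun setT g ->
  P.-integrable setT (fun w => (V w * g (X w))%:E) ->
  P.-integrable setT (fun w => (Z w * g (X w))%:E) ->
  (\int[P]_w (Z w * g (X w))%:E = \int[P]_w (V w * g (X w))%:E)%E.
Proof.
move=> iV iZ ZV mg iVg iZg.
pose gp x := Num.max (g x) 0; pose gn x := Num.max (- g x) 0.
have mgp : measurable_fun setT gp by exact: measurable_maxr.
have mgn : measurable_fun setT gn by apply: measurable_maxr => //; exact: measurableT_comp.
have gp0 x : 0 <= gp x by rewrite le_max lexx orbT.
have gn0 x : 0 <= gn x by rewrite le_max lexx orbT.
have gE x : g x = gp x - gn x.
  by rewrite /gp /gn; case: (leP (g x) 0) => h; case: (leP (- g x) 0) => h'; lra.
have gp1 x : `|gp x| <= `|g x|.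
  by rewrite ger0_norm// /gp ge_max ler_norm normr_ge0.
have gn1 x : `|gn x| <= `|g x|.
  by rewrite ger0_norm// /gn ge_max -normrN ler_norm normr_ge0.
have dom U (h : T' -> R) : P.-integrable setT (EFin \o U) ->
    P.-integrable setT (fun w => (U w * g (X w))%:E) ->
    measurable_fun setT h -> (forall x, `|h x| <= `|g x|) ->
    P.-integrable setT (fun w => (U w * h (X w))%:E).
  move=> iU iUg mh hg; apply: (le_integrable measurableT _ _ iUg).
    apply/measurable_EFinP; apply: measurable_funM.
      by have /integrableP[/measurable_EFinP] := iU.
    by apply: measurableT_comp => //; exact: measurable_funPT.
  by move=> w _; rewrite /= lee_fin !normrM ler_wpM2l.
have split U : P.-integrable setT (EFin \o U) ->
    P.-integrable setT (fun w => (U w * g (X w))%:E) ->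
    (\int[P]_w (U w * g (X w))%:E =
     \int[P]_w (U w * gp (X w))%:E - \int[P]_w (U w * gn (X w))%:E)%E.
  move=> iU iUg; rewrite -integralB//; [|exact: dom|exact: dom].
  by apply: eq_integral => w _; rewrite -EFinB -mulrBr -gE.
rewrite !split//; congr (_ - _)%E; apply: ge0_pull_out => //; exact: dom.
Qed.

End pull_out.

Lemma W2_sqr (R : realType) d (mu nu : probability 'cV[R]_d R) :
  (W2 mu nu ^+ 2)%E = ereal_inf [set c | exists disp (T : measurableType disp)
      (P : probability T R) (X Y : {mfun T >-> 'cV[R]_d}),
    [/\ has_law P X mu, has_law P Y nu &
        c = (\int[P]_w (enorm (X w - Y w) ^+ 2)%:E)%E]].
Proof.
rewrite /W2 sqr_sqrte//; apply: le_ereal_inf_tmp => _ [disp [T [P [X [Y [_ _ ->]]]]]].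
by apply: integral_ge0 => w _; rewrite lee_fin sqr_ge0.
Qed.

Lemma moment_trace_ge0 (R : realType) disp (T : measurableType disp)
    (P : probability T R) n (X : T -> 'cV[R]_n) : 0 <= \tr (moment P X X).
Proof.
apply: sumr_ge0 => i _; rewrite mxE.
by apply: Rintegral_ge0 => w _; rewrite -expr2 sqr_ge0.
Qed.

(** * Costs and minimizers for Gaussian marginals *)

Section gaussian_transport.
Context {R : realType} {d : nat}.
Variables (m_mu m_nu : 'cV[R]_d) (S_mu S_nu B C : 'M[R]_d).
Hypotheses (cov_mu : is_covariance S_mu) (cov_nu : is_covariance S_nu).
Local Notation a := (psd_sqrt S_mu).
Hypotheses (BS : cov_le (B *m B^T) S_nu) (Ca : C *m a = B).
Hypothesis optimal : forall T L : 'M[R]_d,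
  (forall u v : 'cV[R]_d, 0 <= (u^T *m T *m u) 0 0 +
     2 * (u^T *m L *m v) 0 0 + (v^T *m (a *m a) *m v) 0 0) ->
  (forall u : 'cV[R]_d, (u^T *m T *m u) 0 0 <= (u^T *m S_nu *m u) 0 0) ->
  0 <= \tr ((C - 1%:M)^T *m (L - C *m (a *m a))).

Let V := enorm (m_nu - m_mu) ^+ 2 + \tr ((B - a)^T *m (B - a)).
Let mu := gaussian m_mu S_mu.
Let nu := gaussian m_nu S_nu.
Let mubar := gaussian m_nu (B *m B^T).

Let syma : a^T = a. Proof. by apply: covariance_sym; have [] := psd_sqrtP cov_mu. Qed.
Let aa : a *m a = S_mu. Proof. by have [] := psd_sqrtP cov_mu. Qed.
Let cov_bar : is_covariance (B *m B^T). Proof. exact: covariance_gram. Qed.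

Let mongeE : monge m_mu m_nu C = affine_mx (m_nu - C *m m_mu) C.
Proof.
by apply/funext => x; rewrite /monge /affine_mx mulmxBr addrCA addrC.
Qed.

Let measurable_monge : measurable_fun setT (monge m_mu m_nu C).
Proof. by rewrite mongeE; exact: measurable_affine_mx. Qed.

Section coupling.
Context {disp : measure_display} {T : measurableType disp}.
Variables (P : probability T R) (X : {mfun T >-> 'cV[R]_d}).
Hypothesis PX : has_law P X mu.

Let measurable_mongeX : measurable_fun setT (monge m_mu m_nu C \o X).
Proof. by apply: measurableT_comp => //; exact: measurable_funPT. Qed.

Definition monge_rv : {mfun T >-> 'cV[R]_d} :=
  HB.pack_for {mfun T >-> 'cV[R]_d} (monge m_mu m_nu C \o X)
    (isMeasurableFun.Build _ _ _ _ (monge m_mu m_nu C \o X) measurable_mongeX).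

(** Since [C a = B], the map sends [m_mu + a z] to [m_nu + B z]. *)
Lemma monge_has_law : has_law P monge_rv mubar.
Proof.
move=> E mE.
have mXE : measurable (monge m_mu m_nu C @^-1` E).
  by rewrite -[X in measurable X]setTI; exact: measurable_monge.
have aS : a *m a^T = S_mu by rewrite syma.
have h1 := gaussian_has_law m_mu cov_mu aS mXE.
have h2 := gaussian_has_law m_nu cov_bar erefl mE.
apply: etrans (PX mXE) (etrans (esym h1) (etrans _ h2)).
rewrite /distribution /pushforward; congr (std_gaussian d _).
apply/seteqP; split => z /=; congr E;
  by rewrite /monge /affine_mx addrAC subrr add0r mulmxA Ca.
Qed.

Lemma law_mu_moments : [/\ square_integrable_vec P (fun w => X w - m_mu),
  moment P (fun w => X w - m_mu) (fun w => X w - m_mu) = a *m a &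
  moment P (fun w => X w - m_mu) (fun=> 1%:M : 'cV_1) = 0].
Proof. by rewrite aa; exact: gaussian_moments. Qed.

Lemma monge_rv_cost :
  (\int[P]_w (enorm (monge_rv w - X w) ^+ 2)%:E = V%:E)%E.
Proof.
have [sX momX meanX] := law_mu_moments.
rewrite integral_enorm_sqr; last exact: monge_square_integrable.
by congr EFin; exact: (monge_cost m_nu syma Ca sX momX meanX).
Qed.

Lemma coupling_bound (Y : {mfun T >-> 'cV[R]_d}) eta :
  has_law P Y eta -> convex_le eta nu ->
  (V%:E + \int[P]_w (enorm (Y w - monge_rv w) ^+ 2)%:E <=
   \int[P]_w (enorm (X w - Y w) ^+ 2)%:E)%E.
Proof.
move=> PY cvx; have [sX momX meanX] := law_mu_moments.
have [sY meanY momY] := convex_le_moments cov_nu PY cvx.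
have sXY : square_integrable_vec P (fun w => X w - Y w).
  rewrite (_ : (fun w => _) = fun w => (X w - m_mu) - (Y w - m_nu) + (m_mu - m_nu)).
    apply: square_integrable_vecD; first exact: square_integrable_vecB.
    exact: square_integrable_vec_cst.
  by apply/funext => w; apply/colP => i; rewrite !mxE; ring.
rewrite !integral_enorm_sqr//; last exact: monge_gap_square_integrable.
rewrite -EFinD lee_fin.
exact: (monge_bound syma Ca optimal sX sY momX meanX meanY momY).
Qed.

(** Let [W = monge X - X]. Pulling out gives [E<Z, W> = E<Y - X, W> = V + E<Y - monge X, W> >= V],
    and [E|Z - W|^2 >= 0] then yields [E|Z|^2 >= 2 E<Z, W> - V >= V]. *)
Lemma cond_exp_bound (Y : {mfun T >-> 'cV[R]_d}) (Z : T -> 'cV[R]_d) :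
  has_law P Y nu -> is_cond_exp P (sigma_of X) (fun w => Y w - X w) Z ->
  (V%:E <= \int[P]_w (enorm (Z w) ^+ 2)%:E)%E.
Proof.
move=> PY ce; have [sX momX meanX] := law_mu_moments.
have [sY momY meanY] := gaussian_moments cov_nu PY.
(* An infinite cost is trivial; a finite one makes [Z] square integrable, whereas [is_cond_exp] only
   says integrable. *)
have [fin|] := boolP (\int[P]_w (enorm (Z w) ^+ 2)%:E < +oo)%E; last first.
  by rewrite -leNgt leye_eq => /eqP ->; rewrite leey.
have mZ i : measurable_fun setT (fun w => Z w i ord0).
  by have [_ /integrableP[/measurable_EFinP]] := ce i.
have sZ : square_integrable_vec P Z.
  move=> i; split; first exact: mZ.
  apply/integrableP; split.
    by apply/measurable_EFinP; apply: measurable_funX; exact: mZ.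
  apply: le_lt_trans fin; apply: ge0_le_integral => //.
  - by apply: measurableT_comp => //; apply/measurable_EFinP; exact: measurable_funX.
  - apply/measurable_EFinP; under eq_fun do rewrite enorm_sqr.
    by apply: measurable_sum => j; exact: measurable_funX.
  - move=> w _; rewrite lee_fin ger0_norm ?sqr_ge0// enorm_sqr (bigD1 i)//=.
    by rewrite lerDl sumr_ge0// => j _; rewrite sqr_ge0.
pose g x := monge m_mu m_nu C x - x.
have sW : square_integrable_vec P (fun w => g (X w)) by exact: monge_square_integrable.
have sYX : square_integrable_vec P (fun w => Y w - X w).
  rewrite (_ : (fun w => _) = fun w => (Y w - m_nu) - (X w - m_mu) + (m_nu - m_mu)).
    apply: square_integrable_vecD; first exact: square_integrable_vecB.
    exact: square_integrable_vec_cst.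
  by apply/funext => w; apply/colP => i; rewrite !mxE; ring.
have ZW : \tr (moment P Z (fun w => g (X w))) =
    \tr (moment P (fun w => Y w - X w) (fun w => g (X w))).
  apply: eq_bigr => i _; rewrite !mxE /Rintegral; congr fine.
  have [iV iZ _ ZV] := ce i.
  apply: (pull_out (V := fun w => (Y w - X w) i ord0) (g := fun x => g x i ord0)) => //.
  - move=> A mA; apply: ZV; exists A => //; exact: setTI.
  - have /measurable_fun_cVP mm := measurable_monge.
    rewrite (_ : (fun x => _) = fun x => monge m_mu m_nu C x i ord0 - x i ord0).
      by apply: measurable_funB; [exact: mm|exact: measurable_coord].
    by apply/funext => x; rewrite /g mxE [(- x) _ _]mxE.
  - exact: square_integrableM.
  - exact: square_integrableM.
have momY' (u : 'cV[R]_d) :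
    (u^T *m moment P (fun w => Y w - m_nu) (fun w => Y w - m_nu) *m u) 0 0 <=
    (u^T *m S_nu *m u) 0 0 by rewrite momY.
have opt := monge_optimal optimal sX sY momX meanX meanY momY'.
have cost := monge_cost m_nu syma Ca sX momX meanX.
have sD := monge_gap_square_integrable C sX sY.
rewrite integral_enorm_sqr// lee_fin.
have := moment_trace_ge0 P (fun w => Z w - g (X w)).
have sZW := square_integrable_vecB sZ sW.
rewrite (momentBl sZ sW sZW) (momentBr sZ sZ sW) (momentBr sW sZ sW).
rewrite -(moment_tr P Z (fun w => g (X w))) !raddfB /= mxtrace_tr ZW cost.
have YXE : (fun w => Y w - X w) =
    fun w => (Y w - monge m_mu m_nu C (X w)) + g (X w).
  by apply/funext => w; rewrite /g addrA subrK.
rewrite YXE (momentDl sD sW sW) mxtraceD cost.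
move: opt; rewrite -/V /g; lra.
Qed.

End coupling.

Lemma enormBC n (x y : 'cV[R]_n) : enorm (x - y) = enorm (y - x).
Proof.
rewrite /enorm; congr Num.sqrt; apply: eq_bigr => i _.
by rewrite !mxE -sqrrN opprB.
Qed.

Lemma W2_gaussian_ge eta : convex_le eta nu -> (V%:E <= W2 mu eta ^+ 2)%E.
Proof.
move=> cvx; rewrite W2_sqr.
apply: le_ereal_inf_tmp => _ [disp [T [P [X [Y [PX PY ->]]]]]].
apply: le_trans (coupling_bound PX PY cvx); rewrite leeDl//.
by apply: integral_ge0 => w _; rewrite lee_fin sqr_ge0.
Qed.

Let mu_std : has_law (std_gaussian d) (affine_mx m_mu a) mu.
Proof. by apply: gaussian_has_law => //; rewrite syma. Qed.

Lemma W2_gaussian_le eta : same_law eta mubar -> (W2 mu eta ^+ 2 <= V%:E)%E.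
Proof.
move=> etabar; rewrite W2_sqr; apply: ereal_inf_lbound.
pose X : {mfun 'cV[R]_d >-> 'cV[R]_d} := affine_mx m_mu a.
exists cV_display, 'cV[R]_d, (std_gaussian d), X, (monge_rv X); split.
- exact: mu_std.
- by move=> E mE; rewrite (monge_has_law mu_std mE) etabar.
- rewrite -(monge_rv_cost mu_std).
  by apply: eq_integral => w _; rewrite enormBC.
Qed.

(** In a coupling of cost below [V + e], [coupling_bound] leaves less than [e] for the gap between
    [Y] and [monge X], whose law is [mubar] whatever the coupling. *)
Lemma W2_gaussian_unique eta : convex_le eta nu ->
  (W2 mu eta ^+ 2 <= V%:E)%E -> same_law eta mubar.
Proof.
move=> cvx le_V; apply: same_law_close => e e0.
have : (W2 mu eta ^+ 2 < V%:E + e%:E)%E.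
  by apply: le_lt_trans le_V _; rewrite -EFinD lte_fin ltrDl.
rewrite W2_sqr => /ereal_inf_lt[_ [disp [T [P [X [Y [PX PY ->]]]]]] ce].
exists disp, T, P, Y, (monge_rv X); split => //; first exact: monge_has_law.
have := le_lt_trans (coupling_bound PX PY cvx) ce.
by rewrite lteD2lE// => /ltW.
Qed.

Lemma bary_cost_gaussian : bary_cost nu mu = V%:E.
Proof.
apply/eqP; rewrite eq_le; apply/andP; split; last first.
  apply: le_ereal_inf_tmp => _ [disp [T [P [X [Y [Z [PX PY ce ->]]]]]]].
  exact: (cond_exp_bound PX PY ce).
apply: ereal_inf_lbound.
(* [X] and [monge X] use the first half of a Gaussian vector of size [d + d], and the noise [E] the
   second half. *)
have [covE EE] := psd_sqrtP BS; set E := psd_sqrt _ in covE EE.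
pose P := @std_gaussian R (d + d).
pose X : {mfun 'cV[R]_(d + d) >-> 'cV[R]_d} := affine_mx m_mu (row_mx a 0).
pose Y : {mfun 'cV[R]_(d + d) >-> 'cV[R]_d} := affine_mx m_nu (row_mx B E).
have PX : has_law P X mu.
  apply: gaussian_has_law => //.
  by rewrite tr_row_mx mul_row_col mul0mx addr0 syma.
have PY : has_law P Y nu.
  apply: gaussian_has_law => //.
  by rewrite tr_row_mx mul_row_col (covariance_sym covE) EE addrC subrK.
pose Z w := monge m_mu m_nu C (X w) - X w.
have [sX momX meanX] := law_mu_moments PX.
have [sY momY meanY] := gaussian_moments cov_nu PY.
have sZ : square_integrable_vec P Z by exact: monge_square_integrable.
have sYX : square_integrable_vec P (fun w => Y w - X w).
  rewrite (_ : (fun w => _) = fun w => (Y w - m_nu) - (X w - m_mu) + (m_nu - m_mu)).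
    apply: square_integrable_vecD; first exact: square_integrable_vecB.
    exact: square_integrable_vec_cst.
  by apply/funext => w; apply/colP => i; rewrite !mxE; ring.
exists cV_display, 'cV[R]_(d + d), P, X, Y, Z; split => //; last first.
  by rewrite -(monge_rv_cost PX).
move=> i; split.
- exact: (square_integrable_integrable (sYX i)).
- exact: (square_integrable_integrable (sZ i)).
- move=> A mA; exists ((fun x => (monge m_mu m_nu C x - x) i ord0) @^-1` A); last exact: setTI.
  rewrite -[X in measurable X]setTI.
  have : measurable_fun setT (fun x => (monge m_mu m_nu C x - x) i ord0).
    have /measurable_fun_cVP mm := measurable_monge.
    rewrite (_ : (fun x => _) = fun x => monge m_mu m_nu C x i ord0 - x i ord0).
      by apply: measurable_funB; [exact: mm|exact: measurable_coord].
    by apply/funext => x; rewrite mxE [(- x) _ _]mxE.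
  by apply.
move=> _ [A mA <-]; rewrite setTI.
(* Y - X - Z is odd in the second half of the Gaussian vector, which X does
   not involve. *)
pose N (w : 'cV[R]_(d + d)) : 'cV[R]_d := row_mx (0 : 'M[R]_d) E *m w.
have YXN (w : 'cV[R]_(d + d)) : Y w - X w = Z w + N w.
  rewrite /Z /monge (_ : X w - m_mu = row_mx a 0 *m w); last first.
    by rewrite /X /= /affine_mx addrAC subrr add0r.
  rewrite mulmxA mul_mx_row Ca mulmx0; move: (X w) => x.
  rewrite /Y /N /= /affine_mx.
  have -> : row_mx B E *m w = row_mx B 0 *m w + row_mx 0 E *m w.
    by rewrite -mulmxDl add_row_mx addr0 add0r.
  by apply/colP => k; rewrite !mxE; ring.
have sN : square_integrable_vec P N.
  by apply: square_integrable_vec_mul; exact: std_gaussian_square_integrable.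
have iN : P.-integrable setT (fun w => (N w i ord0)%:E).
  exact: (square_integrable_integrable (sN i)).
have iZ : P.-integrable setT (fun w => (Z w i ord0)%:E).
  exact: (square_integrable_integrable (sZ i)).
have mXA : measurable (X @^-1` A).
  by rewrite -[X in measurable X]setTI; apply: (measurable_funPT X).
have N0 : (\int[P]_(w in X @^-1` A) (N w i ord0)%:E = 0)%E.
  pose f w : \bar R := (N w i ord0 * \1_A (X w))%:E.
  have mf : measurable_fun setT f.
    apply/measurable_EFinP; apply: measurable_funM; first by have [] := sN i.
    apply: measurableT_comp; first exact: measurable_indic.
    exact: (measurable_funPT X).
  have fE : (\int[P]_(w in X @^-1` A) (N w i ord0)%:E = \int[P]_w f w)%E.
    rewrite integral_mkcond; apply: eq_integral => w _; rewrite patchE /f indicE.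
    have -> : (X w \in A) = (w \in X @^-1` A) by apply/idP/idP; rewrite !inE.
    by case: ifP => _; rewrite ?mulr1 ?mulr0.
  pose U : 'M[R]_(d + d) := block_mx 1%:M 0 0 (- 1%:M).
  have UU : U *m U^T = 1%:M.
    rewrite tr_block_mx mulmx_block !trmx0 trmx1 !mulmx0 !mul0mx !addr0 !add0r.
    by rewrite mulmx1 [(- 1%:M)^T]raddfN /= trmx1 mulNmx mulmxN mulmx1 opprK -scalar_mx_block.
  have II : 1%:M *m (1%:M : 'M[R]_(d + d))^T = 1%:M by rewrite trmx1 mulmx1.
  have covI : is_covariance (1%:M : 'M[R]_(d + d)).
    by rewrite -II; exact: covariance_gram.
  have h1 := integral_has_law (gaussian_has_law 0 covI UU) mf.
  have h2 := integral_has_law (gaussian_has_law 0 covI II) mf.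
  have h3 : (- (\int[P]_w f w) = \int[P]_w f w)%E.
    have iNf : P.-integrable setT f.
      apply: (le_integrable measurableT mf _ iN) => w _.
      rewrite /f /= lee_fin normrM ler_piMr// indicE.
      by case: (_ \in _); rewrite ?normr1 ?normr0.
    rewrite -integralN; last exact: integrable_add_def iNf.
    apply: etrans (etrans _ (etrans h1 (esym h2))) _.
      apply: eq_integral => w _; rewrite /= /affine_mx add0r /f -mulNr.
      have -> : X (U *m w) = X w.
        rewrite /X /= /affine_mx -{1 2}(vsubmxK w) mul_block_col !mul_row_col.
        by rewrite !mul0mx !addr0 mul1mx.
      have -> : N (U *m w) = - N w.
        rewrite /N -{1 2}(vsubmxK w) mul_block_col !mul_row_col.
        by rewrite !mul0mx !add0r mulNmx mul1mx mulmxN.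
      by rewrite [(- N w) _ _]mxE.
    by apply: eq_integral => w _; rewrite /= /affine_mx add0r mul1mx.
  rewrite fE; move: h3; case: (\int[P]_w f w)%E => // r.
  rewrite -EFinN => -[] h; congr EFin; lra.
rewrite -[LHS]adde0 -N0 -integralD//; [|exact: integrableS iZ|exact: integrableS iN].
by apply: eq_integral => w _; rewrite -EFinD YXN [in RHS]mxE.
Qed.

End gaussian_transport.

Theorem proposition15 (R : realType) (d : nat) (m_mu m_nu : 'cV[R]_d)
    (S_mu S_nu : 'M[R]_d)
    (cov_mu : is_covariance S_mu) (cov_nu : is_covariance S_nu) :
  let mu := gaussian m_mu S_mu in
  let nu := gaussian m_nu S_nu in
  let D := [set S : 'M[R]_d | is_covariance S /\ cov_le S S_nu] in
  let F := fun S : 'M[R]_d =>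
    \tr (S + S_mu - 2 *: psd_sqrt (psd_sqrt S_mu *m S *m psd_sqrt S_mu)) in
  let W := fun S : 'M[R]_d => (W2 mu (gaussian m_nu S) ^+ 2)%E in
  [/\ bary_cost nu mu = ereal_inf [set W S | S in D],
      ereal_inf [set W S | S in D] =
        ((enorm (m_nu - m_mu) ^+ 2)%:E + ereal_inf [set (F S)%:E | S in D])%E &
      exists Sbar : 'M[R]_d,
        [/\ argmin D F = [set Sbar],
            argmin D W = [set Sbar] &
            is_backward_projection mu nu (gaussian m_nu Sbar)]].
Proof.
move=> mu nu D F W.
have [cova aa] := psd_sqrtP cov_mu; have syma := covariance_sym cova.
have [B [C [BS Ca proj opt]]] := backward_matrix syma cov_nu.
pose a := psd_sqrt S_mu; pose Sbar := B *m B^T.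
pose v := \tr ((B - a)^T *m (B - a)).
pose V := enorm (m_nu - m_mu) ^+ 2 + v.
have DSbar : D Sbar by split => //; exact: covariance_gram.
have Dcvx S : D S -> convex_le (gaussian m_nu S) nu.
  by move=> [covS SS]; exact: convex_le_gaussian.
have Wge S : D S -> (V%:E <= W S)%E.
  by move=> DS; exact: (W2_gaussian_ge m_mu cov_mu cov_nu Ca opt (Dcvx _ DS)).
have Wbar_le eta : same_law eta (gaussian m_nu Sbar) -> (W2 mu eta ^+ 2 <= V%:E)%E.
  exact: (W2_gaussian_le m_mu cov_mu Ca).
have WSbar : W Sbar = V%:E.
  by apply/eqP; rewrite eq_le Wge// andbT Wbar_le.
have unique eta : convex_le eta nu -> (W2 mu eta ^+ 2 <= V%:E)%E ->
    same_law eta (gaussian m_nu Sbar).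
  by move=> cvx; exact: (W2_gaussian_unique cov_mu cov_nu Ca opt cvx).
(* Equality of laws becomes equality of matrices because the covariance is read off as a centred
   second moment. *)
have Wunique S : D S -> (W S <= V%:E)%E -> S = Sbar.
  move=> DS WS; have [covS _] := DS.
  have law := unique _ (Dcvx _ DS) WS.
  have AA : psd_sqrt S *m (psd_sqrt S)^T = S.
    by have [covs sE] := psd_sqrtP covS; rewrite (covariance_sym covs).
  have XS := gaussian_has_law m_nu covS AA.
  have XSbar : has_law (std_gaussian d) (affine_mx m_nu (psd_sqrt S)) (gaussian m_nu Sbar).
    by move=> E mE; rewrite (XS _ mE) law.
  have [_ momS _] := gaussian_moments covS XS.
  have [_ momSbar _] := gaussian_moments (covariance_gram B) XSbar.
  exact: etrans (esym momS) momSbar.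
(* For a factor [B'] of [S] with [F S = |B' - a|^2], the projection inequality
   [v + |B' - B|^2 <= F S] gives both the bound and its case of equality. *)
have Fge S : D S -> v <= F S /\ (F S <= v -> S = Sbar).
  move=> [covS SS]; have [B' B'S] := bures_ex syma covS; rewrite aa.
  rewrite -/(F S) => ->; rewrite -B'S in SS.
  have := proj _ SS; have := frob_ge0 (B' - B); rewrite -/a -/v => h1 h2.
  split=> [|h3]; first by lra.
  have /frob_eq0/subr0_eq B'B : \tr ((B' - B)^T *m (B' - B)) = 0 by lra.
  by rewrite -B'S B'B.
(* The upper bound takes [B] itself as a factor of [Sbar]. *)
have FSbar : F Sbar = v.
  apply/eqP; rewrite eq_le (Fge _ DSbar).1 andbT.
  by have := bures_le syma (covariance_gram B) erefl; rewrite aa.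
have infW : ereal_inf [set W S | S in D] = V%:E.
  apply/eqP; rewrite eq_le; apply/andP; split.
    by rewrite -WSbar; apply: ereal_inf_lbound; exists Sbar.
  by apply: le_ereal_inf_tmp => _ [S DS <-]; exact: Wge.
have infF : ereal_inf [set (F S)%:E | S in D] = v%:E.
  apply/eqP; rewrite eq_le; apply/andP; split.
    by rewrite -FSbar; apply: ereal_inf_lbound; exists Sbar.
  by apply: le_ereal_inf_tmp => _ [S DS <-]; rewrite lee_fin (Fge _ DS).1.
split; first by rewrite infW; exact: (bary_cost_gaussian m_mu m_nu cov_mu cov_nu BS Ca opt).
  by rewrite infW infF -EFinD.
exists Sbar; split.
- apply/seteqP; split => [S [DS minS]|_ ->] /=.
    by apply: (Fge _ DS).2; rewrite -FSbar; exact: minS.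
  by split => // S DS; rewrite FSbar; exact: (Fge _ DS).1.
- apply/seteqP; split => [S [DS minS]|_ ->] /=.
    by apply: Wunique => //; rewrite -WSbar; exact: minS.
  by split => // S DS; rewrite WSbar; exact: Wge.
(* A minimizer costs at most as much as the admissible law with covariance [Sbar], that is [V].
   Conversely, convex order and cost only see a law on measurable sets, so every law equal there to
   that one inherits both. *)
- move=> eta; split=> [[cvx mineta]|law].
    by apply: unique => //; rewrite -WSbar; apply: mineta; exact: Dcvx.
  split=> [h cvxh|xi cvx].
    rewrite (eq_measure_integral (gaussian m_nu Sbar)); last by move=> A mA _; exact: law.
    exact: Dcvx.
  apply: le_trans (Wbar_le _ law) _.
  exact: (W2_gaussian_ge m_mu cov_mu cov_nu Ca opt cvx).
Qed.
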